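(* Let $\mathcal{C}$ be a polyhedral complex in $\mathbb{R}^n$, let $F:|\mathcal{C}|\to\mathbb{R}$ be affine-linear on each cell of $\mathcal{C}$, and let $[a,b]$ be an interval of transversal thresholds for $F$ on $\mathcal{C}$. Then there exist a polytopal complex $\mathcal{D}$ with $|\mathcal{D}|\subseteq|\mathcal{C}|$ and a strong deformation retraction of $|\mathcal{C}|$ onto $|\mathcal{D}|$ whose time-one map $\Phi:|\mathcal{C}|\to|\mathcal{D}|$ satisfies: $F(\Phi(x))=F(x)$ for every $x\in|\mathcal{C}|$ with $F(x)\in[a,b]$, and for every $c\in[a,b]$, $$\Phi(\{x\in|\mathcal{C}|:F(x)\le c\})=\{y\in|\mathcal{D}|:F(y)\le c\},\qquad \Phi(\{x\in|\mathcal{C}|:F(x)\ge c\})=\{y\in|\mathcal{D}|:F(y)\ge c\}.$$ Furthermore, for every $c\in[a,b]$ there is a PL homeomorphism $\phi:(|\mathcal{D}|\cap F^{-1}(c))\times[a,b]\to|\mathcal{D}|\cap F^{-1}([a,b])$ such that for each $t\in[a,b]$ the restriction of $\phi$ to $(|\mathcal{D}|\cap F^{-1}(c))\times\{t\}$ is a PL homeomorphism onto $|\mathcal{D}|\cap F^{-1}(t)$.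
   Context: A polyhedral set in $\mathbb{R}^n$ is an intersection of finitely many closed affine half-spaces; a polytope is a bounded polyhedral set. A face of a polyhedral set $P$ is $\emptyset$, $P$, or $P\cap H$ for a hyperplane $H$ meeting $P$ with $P$ contained in one closed half-space of $H$. A polyhedral complex is a finite set $\mathcal{C}$ of polyhedral sets (cells) such that every face of a cell is a cell and any two cells intersect in a common face; $|\mathcal{C}|$ is the union of its cells; a polytopal complex is a polyhedral complex all of whose cells are polytopes. For $F:|\mathcal{C}|\to\mathbb{R}$ affine-linear on each cell, a cell $C$ is flat if $F$ is constant on $C$ (all $0$-cells are flat). A closed interval $[a,b]$ is an interval of transversal thresholds for $F$ on $\mathcal{C}$ if no flat cell $C$ of $\mathcal{C}$ has $F(C)\subseteq[a,b]$. A strong deformation retraction of $X$ onto $A\subseteq X$ is a continuous $H:X\times[0,1]\to X$ with $H(x,0)=x$, $H(x,1)\in A$, $H(a,t)=a$ for all $x\in X$, $a\in A$, $t$. *)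

(* Defs.v *)
From HB Require Import structures.
From mathcomp Require Import all_boot all_order all_algebra.
From mathcomp Require Import all_classical all_reals all_analysis.
Set Implicit Arguments. Unset Strict Implicit. Unset Printing Implicit Defensive.
Import Order.TTheory GRing.Theory Num.Theory.
Import numFieldNormedType.Exports.
Local Open Scope classical_set_scope.
Local Open Scope ring_scope.

Definition dotv (R : realType) (n : nat) (u v : 'rV[R]_n) : R :=
  \sum_(i < n) u 0 i * v 0 i.

Definition polyhedral_set (R : realType) (n : nat) (P : set 'rV[R]_n) : Prop :=
  exists s : seq ('rV[R]_n * R),
    P = [set x | forall h, h \in s -> dotv h.1 x <= h.2].

Definition bounded_set (R : realType) (n : nat) (P : set 'rV[R]_n) : Prop :=
  exists r : R, forall x, P x -> forall i, `|x 0 i| <= r.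

Definition polytope (R : realType) (n : nat) (P : set 'rV[R]_n) : Prop :=
  polyhedral_set P /\ bounded_set P.

Definition face (R : realType) (n : nat) (P G : set 'rV[R]_n) : Prop :=
  G = set0 \/ G = P \/
  exists (a : 'rV[R]_n) (b : R),
    a != 0 /\ (exists x, P x /\ dotv a x = b) /\
    (forall x, P x -> dotv a x <= b) /\
    G = P `&` [set x | dotv a x = b].

Definition polyhedral_complex (R : realType) (n : nat)
    (C : set (set 'rV[R]_n)) : Prop :=
  finite_set C /\
  (forall P, C P -> polyhedral_set P) /\
  (forall P G, C P -> face P G -> C G) /\
  (forall P Q, C P -> C Q -> face P (P `&` Q) /\ face Q (P `&` Q)).

Definition polytopal_complex (R : realType) (n : nat)
    (C : set (set 'rV[R]_n)) : Prop :=
  polyhedral_complex C /\ (forall P, C P -> polytope P).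

Definition cplx_support (R : realType) (n : nat) (C : set (set 'rV[R]_n))
  : set 'rV[R]_n := \bigcup_(P in C) P.

Definition affine_on_cells (R : realType) (n : nat) (C : set (set 'rV[R]_n))
    (F : 'rV[R]_n -> R) : Prop :=
  forall P, C P -> exists (a : 'rV[R]_n) (b : R),
    forall x, P x -> F x = dotv a x + b.

Definition flat_cell (R : realType) (n : nat) (F : 'rV[R]_n -> R)
    (P : set 'rV[R]_n) : Prop :=
  P !=set0 /\ exists v : R, forall x, P x -> F x = v.

Definition transversal_thresholds (R : realType) (n : nat)
    (C : set (set 'rV[R]_n)) (F : 'rV[R]_n -> R) (a b : R) : Prop :=
  forall P, C P -> flat_cell F P -> ~ (F @` P `<=` [set y | a <= y <= b]).

Definition strong_deformation_retraction (R : realType) (n : nat)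
    (X A : set 'rV[R]_n) (H : 'rV[R]_n -> R -> 'rV[R]_n) : Prop :=
  {within [set p : 'rV[R]_n * R | X p.1 /\ 0 <= p.2 <= 1],
     continuous (fun p : 'rV[R]_n * R => H p.1 p.2)} /\
  (forall x t, X x -> 0 <= t <= 1 -> X (H x t)) /\
  (forall x, X x -> H x 0 = x) /\
  (forall x, X x -> A (H x 1)) /\
  (forall y t, A y -> 0 <= t <= 1 -> H y t = y).

Definition PL_map (R : realType) (k m : nat) (A : set 'rV[R]_k)
    (f : 'rV[R]_k -> 'rV[R]_m) : Prop :=
  exists (N : nat) (P : 'I_N -> set 'rV[R]_k),
    (forall i, polyhedral_set (P i)) /\
    A = \bigcup_(i in [set: 'I_N]) P i /\
    (forall i, exists (M : 'M[R]_(k, m)) (w : 'rV[R]_m),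
        forall x, P i x -> f x = x *m M + w).

Definition PL_homeo (R : realType) (k m : nat) (A : set 'rV[R]_k)
    (B : set 'rV[R]_m) (f : 'rV[R]_k -> 'rV[R]_m) : Prop :=
  PL_map A f /\ {within A, continuous f} /\ f @` A = B /\
  exists g : 'rV[R]_m -> 'rV[R]_k,
    PL_map B g /\ {within B, continuous g} /\
    (forall x, A x -> g (f x) = x) /\ (forall y, B y -> f (g y) = y).

(* the point (x, t) of R^n x R = R^(n+1) *)
Definition pt (R : realType) (n : nat) (x : 'rV[R]_n) (t : R) : 'rV[R]_(n + 1) :=
  row_mx x (const_mx t).

(* Main.v *)
Require Import Defs.
From HB Require Import structures.
From mathcomp Require Import all_boot all_order all_algebra.
From mathcomp Require Import all_classical all_reals all_analysis.
From mathcomp Require Import ring lra.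
Import Order.TTheory GRing.Theory Num.Theory.
Import numFieldNormedType.Exports.
Local Open Scope classical_set_scope.
Local Open Scope ring_scope.

(* Cut every cell at level [a] only. A cell [s] on which [F] takes a value in the
   interval takes values on both sides of it (else walking down [F] inside [s]
   would end in a flat cell of the interval), so the pieces of [s] below and above
   [a] can be given apexes in the relative interior of [s], at the levels [a] and
   [b'], where [b' > b] is chosen so that [[a, b']] is still transversal. Coning
   off inductively from the apexes subdivides the bounded directions of each piece
   into simplices spanned by chains of apexes; these form the complex [D]. A point
   of a piece with apex [p] follows, in proportion, the retraction of the point
   where its ray from [p] leaves the piece, and moves to [p] itself when the ray
   never leaves; as the pieces above [a] have their apexes at level [b'], this respects [F] on the
   interval. Over [[a, b']] the simplices of [D] are those of the standard
   triangulation of the product of [D] at level [a] with an interval. *)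

Set Implicit Arguments.
Unset Strict Implicit.
Unset Printing Implicit Defensive.

(** Unbounded cells are the obstacle. They need not have vertices, so the vertices of [D] are chosen
    points, and a ray from such a point may never leave its piece. Sending the points of such a ray
    to the apex is continuous because the share of weight handed on to the exit point tends to 0,
    even when exit points run off to infinity. The computations use weight functions on the finite
    set of apexes rather than simplices. One fact, that the weights of a point of [D] can be
    recovered from the point, yields affine independence, intersection in common faces and the fact
    that the retraction fixes [D]. The interval is widened because [a = b] is allowed, while lower
    and upper apexes need two distinct levels. No cut at the upper level is needed: coning from an
    apex at level [b'] is affine in [F], so it keeps the levels in the interval once they are kept
    at the exit point, and a point of [D] in the slab only involves apexes at the two levels [a] and
    [b']. *)

Section DotProduct.
Variables (R : realType) (n : nat).
Implicit Types (u x y : 'rV[R]_n) (t : R).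

Lemma dotvDr u x y : dotv u (x + y) = dotv u x + dotv u y.
Proof. by rewrite /dotv -big_split; apply: eq_bigr => i _; rewrite mxE mulrDr. Qed.

Lemma dotvZr t u x : dotv u (t *: x) = t * dotv u x.
Proof. by rewrite /dotv mulr_sumr; apply: eq_bigr => i _; rewrite mxE mulrCA. Qed.

Lemma dotvNr u x : dotv u (- x) = - dotv u x.
Proof. by rewrite -scaleN1r dotvZr mulN1r. Qed.

Lemma dotvBr u x y : dotv u (x - y) = dotv u x - dotv u y.
Proof. by rewrite dotvDr dotvNr. Qed.

Lemma dotv0l x : dotv 0 x = 0.
Proof. by rewrite /dotv big1 // => i _; rewrite mxE mul0r. Qed.

Lemma dotv0r u : dotv u 0 = 0.
Proof. by rewrite /dotv big1 // => i _; rewrite mxE mulr0. Qed.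

Lemma dotvNl u x : dotv (- u) x = - dotv u x.
Proof. by rewrite /dotv -sumrN; apply: eq_bigr => i _; rewrite mxE mulNr. Qed.

Lemma dotv_sumr (I : finType) u (c : I -> R) (v : I -> 'rV[R]_n) :
  dotv u (\sum_i c i *: v i) = \sum_i c i * dotv u (v i).
Proof.
apply: (big_ind2 (fun x t => dotv u x = t)) => //; first exact: dotv0r.
  by move=> x1 x2 y1 y2 <- <-; rewrite dotvDr.
by move=> i _; rewrite dotvZr.
Qed.

Lemma dotv_comb u x y t :
  dotv u (x + t *: (y - x)) = dotv u x + t * (dotv u y - dotv u x).
Proof. by rewrite dotvDr dotvZr dotvBr. Qed.

Lemma dotv_mulmx m (A : 'M[R]_(m, n)) u (x : 'rV[R]_m) :
  dotv u (x *m A) = dotv (u *m A^T) x.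
Proof.
rewrite /dotv.
under eq_bigr do rewrite mxE mulr_sumr.
under [RHS]eq_bigr do rewrite mxE mulr_suml.
rewrite exchange_big; apply: eq_bigr => i _; apply: eq_bigr => j _.
by rewrite !mxE mulrCA mulrC.
Qed.

Lemma dotv_delta (i : 'I_n) x : dotv (delta_mx 0 i) x = x 0 i.
Proof.
rewrite /dotv (bigD1 i) //= big1 ?addr0 => [|j ji]; rewrite mxE ?eqxx ?mul1r //.
by rewrite (negbTE ji) andbF mul0r.
Qed.

Lemma cvg_dotv u (T : Type) (Fi : set_system T) (FF : Filter Fi)
    (f : T -> 'rV[R]_n) (l : 'rV[R]_n) :
  f @ Fi --> l -> (fun z => dotv u (f z)) @ Fi --> dotv u l.
Proof.
move=> fl; rewrite /dotv.
apply: (@cvg_big _ _ (fun x y : R => x + y)) => //; first exact: add_continuous.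
move=> i _; apply: cvgM; first exact: cvg_cst.
exact: (@cvg_comp _ _ _ f (fun x : 'rV[R]_n => x 0 i) Fi (nbhs l) (nbhs (l 0 i))
  fl (@coord_continuous _ 1 n 0 i l)).
Qed.

Lemma dotv_continuous u : continuous (dotv u).
Proof. by move=> x; apply: (@cvg_dotv u _ (nbhs x) _ id x); exact: cvg_id. Qed.

Lemma cvg_rV (T : Type) (Fi : set_system T) (FF : Filter Fi)
    (f : T -> 'rV[R]_n) (l : 'rV[R]_n) :
  (forall i, (fun z => f z 0 i) @ Fi --> l 0 i) -> f @ Fi --> l.
Proof.
move=> fl A [B nB sBA].
have : Fi (fun z => forall j, B 0 j (f z 0 j)).
  by apply: filter_forall => j; apply: (fl j); apply: (nB 0 j).
by apply: (@filterS _ Fi FF) => z zB; apply: sBA => i j; rewrite (ord1 i).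
Qed.

End DotProduct.

(** Near a point of the union only the closed sets through it matter: the finitely many others miss
    a neighbourhood of it. *)
Lemma within_bigcup_continuous (T U : topologicalType) (I : finType) (P : pred I)
    (B : I -> set T) (f : T -> U) :
  (forall i, closed (B i)) -> (forall i, P i -> {within B i, continuous f}) ->
  {within \bigcup_(i in [set i | P i]) B i, continuous f}.
Proof.
move=> Bc fc; apply/subspace_continuousP => x _ V Vx.
have : \forall y \near x, forall i, P i -> B i y -> V (f y).
  apply: filter_forall => i; have [Pi|] := boolP (P i); last by move=> _; apply: nearW.
  have [Bx|nBx] := pselect (B i x).
    have /subspace_continuousP/(_ _ Bx)/(_ V Vx) := fc _ Pi.
    rewrite /nbhs /= /within /=; apply: filterS => y H _; exact: H.
  have /closed_openC := Bc i; rewrite openE => /(_ x nBx).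
  by rewrite /interior; apply: filterS => y nBy _ /nBy.
by apply: filterS => y H [i Pi Biy]; apply: (H i).
Qed.

(** * Polyhedra presented by lists of half-spaces *)

Section Halfspaces.
Variables (R : realType) (n : nat).
Implicit Types (L : seq ('rV[R]_n * R)) (x y p : 'rV[R]_n).

Definition hpoly L : set 'rV[R]_n := [set x | forall h, h \in L -> dotv h.1 x <= h.2].

Lemma hpoly_comb L x y t : hpoly L x -> hpoly L y -> 0 <= t <= 1 ->
  hpoly L (x + t *: (y - x)).
Proof. move=> Lx Ly /andP[t0 t1] h hL; have := Lx h hL; have := Ly h hL; rewrite dotv_comb; nra. Qed.

Lemma hpoly_cat L L' : hpoly (L ++ L') = hpoly L `&` hpoly L'.
Proof.
apply/seteqP; split => [x Lx|x [Lx L'x] h].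
  by split=> h hL; apply: Lx; rewrite mem_cat hL ?orbT.
by rewrite mem_cat => /orP[]; [apply: Lx|apply: L'x].
Qed.

Lemma hpoly_closed L : closed (hpoly L).
Proof.
have -> : hpoly L = \bigcap_(h in [set` L]) [set x | dotv h.1 x <= h.2].
  by apply/seteqP; split.
apply: closed_bigI => h _.
have := @closed_comp _ _ (dotv h.1) [set r | r <= h.2].
by apply; [move=> x _; apply: dotv_continuous|exact: closed_le].
Qed.

Lemma hpoly_sum (I : finType) L (w : I -> R) (v : I -> 'rV[R]_n) :
  (forall i, 0 <= w i) -> \sum_i w i = 1 ->
  (forall i, w i != 0 -> hpoly L (v i)) -> hpoly L (\sum_i w i *: v i).
Proof.
move=> w0 w1 Lv h hL; rewrite dotv_sumr -[leRHS]mul1r -w1 mulr_suml.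
apply: ler_sum => i _; have [->|wi] := eqVneq (w i) 0; first by rewrite !mul0r.
by apply: ler_wpM2l => //; apply: Lv.
Qed.

End Halfspaces.

(** * The gauge of a polyhedron seen from one of its points *)

Section Gauge.
Variables (R : realType) (n : nat) (L : seq ('rV[R]_n * R)) (p : 'rV[R]_n).
Implicit Types x y : 'rV[R]_n.

Definition strict_at : pred ('rV[R]_n * R) := fun h => dotv h.1 p < h.2.

(** The Minkowski gauge with the origin moved to [p]. Constraints tight at [p] would have
    denominator 0 and are left out; the maximum starts at 0, its value when no strict constraint
    grows towards [x]. *)
Definition gauge x : R :=
  \big[Num.max/0]_(h <- L | strict_at h) ((dotv h.1 x - dotv h.1 p) / (h.2 - dotv h.1 p)).

(* The point where the ray from [p] through [x] leaves [hpoly L] ([p] itself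
   if it never does, since then [(gauge x)^-1 = 0]). *)
Definition exit_pt x := p + (gauge x)^-1 *: (x - p).

(** Facets through [p] are not counted, as they consist of segments from [p]. This matters for the
    pieces below [a], whose apex may lie on the facet at level [a]. *)
Definition rbd x := has (fun h => strict_at h && (dotv h.1 x == h.2)) L.

Lemma gauge_ge0 x : 0 <= gauge x.
Proof. exact: bigmax_ge_id. Qed.

Lemma gauge_ge x h : h \in L -> strict_at h ->
  dotv h.1 x - dotv h.1 p <= gauge x * (h.2 - dotv h.1 p).
Proof.
move=> hL hs; have hs0 : 0 < h.2 - dotv h.1 p by rewrite subr_gt0.
rewrite -ler_pdivrMr //; exact: (@bigmax_sup_seq _ _ _ L 0 h strict_at _ (fun h : 'rV[R]_n * R => (dotv h.1 x - dotv h.1 p) / (h.2 - dotv h.1 p)) hL hs).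
Qed.

Lemma gauge_le x t : 0 <= t ->
  (forall h, h \in L -> strict_at h ->
    dotv h.1 x - dotv h.1 p <= t * (h.2 - dotv h.1 p)) -> gauge x <= t.
Proof.
move=> t0 H; rewrite /gauge big_seq_cond; elim/big_ind: _ => //.
  by move=> u v ut vt; rewrite ge_max ut.
by move=> h /andP[hL hs]; rewrite ler_pdivrMr ?subr_gt0 //; apply: H.
Qed.

Lemma gauge_scale x t : 0 <= t -> gauge (p + t *: (x - p)) = t * gauge x.
Proof.
move=> t0; have E h : (dotv h.1 (p + t *: (x - p)) - dotv h.1 p) = t * (dotv h.1 x - dotv h.1 p).
  by rewrite dotv_comb; lra.
apply/eqP; rewrite eq_le; apply/andP; split.
  apply: gauge_le => [|h hL hs]; first by rewrite mulr_ge0 ?gauge_ge0.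
  by rewrite E -mulrA ler_wpM2l // gauge_ge.
have [->|tn0] := eqVneq t 0; first by rewrite mul0r gauge_ge0.
have {t0 tn0} t0 : 0 < t by rewrite lt_def tn0.
rewrite -ler_pdivlMl //; apply: gauge_le => [|h hL hs].
  by rewrite mulr_ge0 ?gauge_ge0 // invr_ge0 ltW.
by rewrite -mulrA ler_pdivlMl // -E gauge_ge.
Qed.

Lemma gauge_continuous : continuous gauge.
Proof.
move=> x; apply: (cvg_big (op := fun u v : R => Num.max u v) max_continuous (nbhs_filter x)) => h _; apply: cvgM; last exact: cvg_cst.
by apply: cvgB; [apply: dotv_continuous|apply: cvg_cst].
Qed.

Hypothesis Lp : hpoly L p.

Lemma gauge_le1 x : hpoly L x -> gauge x <= 1.
Proof.
move=> Lx; apply: gauge_le => // h hL hs; rewrite mul1r lerD2r; exact: Lx.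
Qed.

Lemma gauge_rbd x : hpoly L x -> gauge x = 1 <-> rbd x.
Proof.
move=> Lx; split=> [g1|/hasP[h hL /andP[hs /eqP hx]]].
  apply/contraT => /hasPn nb.
  suff : gauge x < 1 by rewrite g1 ltxx.
  rewrite /gauge big_seq_cond; elim/big_ind: _ => //.
    by move=> u v ut vt; rewrite gt_max ut.
  move=> h /andP[hL hs]; rewrite ltr_pdivrMr ?subr_gt0 // mul1r ltrD2r.
  by rewrite lt_neqAle Lx // andbT; have := nb h hL; rewrite hs.
apply/eqP; rewrite eq_le gauge_le1 //=.
have := gauge_ge x hL hs; rewrite hx.
by rewrite -[leLHS]mul1r ler_pM2r // subr_gt0.
Qed.


Lemma exit_ptK x : gauge x != 0 -> p + gauge x *: (exit_pt x - p) = x.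
Proof. by move=> g0; rewrite /exit_pt addrAC subrr add0r scalerA divff // scale1r addrC subrK. Qed.

Lemma gauge_exit x : gauge x != 0 -> gauge (exit_pt x) = 1.
Proof. by move=> g0; rewrite gauge_scale ?invr_ge0 ?gauge_ge0 // mulVf. Qed.

Lemma exit_pt_id x : gauge x = 1 -> exit_pt x = x.
Proof. by move=> g1; rewrite /exit_pt g1 invr1 scale1r addrC subrK. Qed.

Lemma exit_pt_scale x t : gauge x = 1 -> 0 < t -> exit_pt (p + t *: (x - p)) = x.
Proof.
move=> g1 t0; rewrite /exit_pt gauge_scale ?ltW // g1 mulr1 addrAC subrr add0r.
by rewrite scalerA mulVf ?gt_eqF // scale1r addrC subrK.
Qed.

Lemma exit_pt_in x : hpoly L x -> hpoly L (exit_pt x).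
Proof.
move=> Lx h hL; rewrite dotv_comb.
have [hs|hs] := boolP (strict_at h).
  have [->|g0] := eqVneq (gauge x) 0; first by rewrite invr0 mul0r addr0 Lp.
  have {}g0 : 0 < gauge x by rewrite lt_def g0 gauge_ge0.
  by rewrite -lerBrDl ler_pdivrMl // gauge_ge.
(* A constraint tight at [p] does not increase towards [x], so no nonnegative rescaling of [x - p]
   violates it. *)
have ph : dotv h.1 p = h.2 by apply/eqP; rewrite eq_le Lp //= leNgt.
rewrite ph gerDl mulr_ge0_le0 ?invr_ge0 ?gauge_ge0 // subr_le0; exact: Lx.
Qed.

End Gauge.

(** * Closure properties of polyhedral sets *)

Section PolyhedralSets.
Variables (R : realType) (n : nat).
Implicit Types P Q : set 'rV[R]_n.


Lemma polyhedral_halfspace (u : 'rV[R]_n) (c : R) : polyhedral_set [set x | dotv u x <= c].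
Proof.
exists [:: (u, c)]; apply/seteqP; split=> x /= H => [h|]; first by rewrite inE => /eqP->.
by apply: (H (u, c)); rewrite inE.
Qed.

Lemma polyhedral_setI P Q : polyhedral_set P -> polyhedral_set Q -> polyhedral_set (P `&` Q).
Proof. by move=> [s ->] [t ->]; exists (s ++ t); rewrite -/(hpoly (s ++ t)) hpoly_cat. Qed.

Lemma polyhedral_setT : polyhedral_set [set: 'rV[R]_n].
Proof. by exists [::]; apply/seteqP; split. Qed.

Lemma polyhedral_set0 : polyhedral_set (set0 : set 'rV[R]_n).
Proof.
exists [:: (0, -1)]; apply/seteqP; split=> x //= /(_ (0, -1)).
by rewrite inE eqxx dotv0l => /(_ isT) /=; lra.
Qed.

Lemma polyhedral_forall (J : finType) (P : J -> set 'rV[R]_n) :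
  (forall j, polyhedral_set (P j)) -> polyhedral_set [set x | forall j, P j x].
Proof.
move=> polyP.
have H (r : seq J) : polyhedral_set [set x | forall j, j \in r -> P j x].
  elim: r => [|j r IH].
    by rewrite (_ : [set _ | _] = setT); [exact: polyhedral_setT|apply/seteqP; split].
  rewrite (_ : [set _ | _] = P j `&` [set x | forall j, j \in r -> P j x]).
    exact: polyhedral_setI.
  apply/seteqP; split=> x /= => [Hx|[Hj Hr] k].
    by split=> [|k kr]; apply: Hx; rewrite inE ?eqxx // kr orbT.
  by rewrite inE => /orP[/eqP->|/Hr].
have := H (enum J); congr polyhedral_set; apply/seteqP; split=> x /= Hx j => [|_]; last exact: Hx.
by apply: Hx; rewrite mem_enum.
Qed.

Lemma polyhedral_coord (i : 'I_n) (c : R) : polyhedral_set [set x | x 0 i <= c].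
Proof.
have := polyhedral_halfspace (delta_mx 0 i) c; congr polyhedral_set.
by apply/seteqP; split=> x /=; rewrite dotv_delta.
Qed.

Lemma polyhedral_preim m (P : set 'rV[R]_m) (M : 'M[R]_(n, m)) (c : 'rV[R]_m) :
  polyhedral_set P -> polyhedral_set [set x | P (x *m M + c)].
Proof.
case=> s ->; exists [seq (h.1 *m M^T, h.2 - dotv h.1 c) | h <- s].
apply/seteqP; split=> x /= H => [_ /mapP[h hs ->]|h hs].
  by have := H h hs; rewrite dotvDr dotv_mulmx lerBrDr.
by have := H _ (map_f _ hs); rewrite /= dotvDr dotv_mulmx lerBrDr.
Qed.

Lemma polyhedral_coordge (i : 'I_n) (c : R) : polyhedral_set [set x | c <= x 0 i].
Proof.
have := polyhedral_halfspace (- delta_mx 0 i) (- c); congr polyhedral_set.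
by apply/seteqP; split=> x /=; rewrite dotvNl dotv_delta lerN2.
Qed.

Lemma polyhedral_point (v : 'rV[R]_n) : polyhedral_set [set v].
Proof.
have -> : [set v] = [set x | forall i, (x 0 i <= v 0 i) /\ (v 0 i <= x 0 i)].
  apply/seteqP; split=> x /= => [->|H]; first by [].
  by apply/rowP => i; apply/eqP; have [h1 h2] := H i; rewrite eq_le h1.
by apply: polyhedral_forall => i; apply: polyhedral_setI;
  [apply: polyhedral_coord|apply: polyhedral_coordge].
Qed.

Lemma polyhedral_closed P : polyhedral_set P -> closed P.
Proof. by case=> s ->; apply: hpoly_closed. Qed.

End PolyhedralSets.

(** * Barycentric weights and simplices *)

Section Simplices.
Variables (R : realType) (I : finType).
Implicit Types (w : I -> R) (T : {set I}).

(** Weights live on all of [I] with support in [T], so that weights of different simplices can be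
    compared directly. *)
Definition weights T w :=
  [/\ forall i, 0 <= w i, \sum_i w i = 1 & forall i, w i != 0 -> i \in T].

Definition bary m (q : I -> 'rV[R]_m) w : 'rV[R]_m := \sum_i w i *: q i.

Definition simplex m (q : I -> 'rV[R]_m) T : set 'rV[R]_m :=
  [set y | exists2 w, weights T w & y = bary q w].

Lemma bary_affine m k (q : I -> 'rV[R]_m) (M : 'M[R]_(m, k)) c w :
  \sum_i w i = 1 -> bary q w *m M + c = bary (fun i => q i *m M + c) w.
Proof.
move=> w1; rewrite /bary mulmx_suml -[c in LHS]scale1r -w1 scaler_suml -big_split.
by apply: eq_bigr => i _; rewrite scalerDr scalemxAl.
Qed.

Lemma eq_bary m (q q' : I -> 'rV[R]_m) w :
  (forall i, w i != 0 -> q i = q' i) -> bary q w = bary q' w.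
Proof.
move=> E; apply: eq_bigr => i _; have [->|/E->//] := eqVneq (w i) 0.
by rewrite !scale0r.
Qed.

Definition vertex_weight (i : I) : I -> R := fun j => (j == i)%:R.

Lemma weights_vertex T i : i \in T -> weights T (vertex_weight i).
Proof.
move=> iT; rewrite /vertex_weight; split=> [j||j]; first by case: eqP.
  by rewrite (bigD1 i) //= eqxx big1 ?addr0 // => j /negbTE->.
by have [->//|] := eqVneq j i; rewrite eqxx.
Qed.

Lemma bary_vertex m (q : I -> 'rV[R]_m) i : bary q (vertex_weight i) = q i.
Proof.
rewrite /bary /vertex_weight (bigD1 i) //= eqxx scale1r big1 ?addr0 // => j /negbTE->.
by rewrite scale0r.
Qed.

Lemma weightsS T T' w : (forall i, i \in T -> i \in T') -> weights T w -> weights T' w.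
Proof. by move=> s [w0 w1 wT]; split=> // i /wT/s. Qed.

Section AffineIndependence.
Variables (m : nat) (q : I -> 'rV[R]_m) (T : {set I}).
Hypothesis inj : forall w w', weights T w -> weights T w' -> bary q w = bary q w' -> w =1 w'.

(** The positive and negative parts of [c] have equal mass and equal weighted sums; divided by that
    mass they become two weightings of one point, which [inj] identifies. *)
Lemma aff_indep (c : I -> R) : (forall i, c i != 0 -> i \in T) ->
  \sum_i c i = 0 -> \sum_i c i *: q i = 0 -> c =1 fun=> 0.
Proof.
move=> cT c0 cq0.
pose cp i := Num.max (c i) 0; pose cm i := Num.max (- c i) 0.
have cpE i : c i = cp i - cm i by rewrite /cp /cm; case: (leP (c i) 0); case: (leP (- c i) 0); lra.
have cp0 i : 0 <= cp i by rewrite le_max lexx orbT.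
have cm0 i : 0 <= cm i by rewrite le_max lexx orbT.
have Es : \sum_i cp i = \sum_i cm i.
  by apply/eqP; rewrite -subr_eq0 -sumrB; apply/eqP; rewrite -[RHS]c0; apply: eq_bigr.
have Eq : \sum_i cp i *: q i = \sum_i cm i *: q i.
  apply/eqP; rewrite -subr_eq0 -sumrB; apply/eqP; rewrite -[RHS]cq0.
  by apply: eq_bigr => i _; rewrite cpE scalerBl.
set s := \sum_i cp i in Es; have [s0|s0] := eqVneq s 0.
  move=> i; rewrite cpE (psumr_eq0P (P := xpredT) (fun i _ => cp0 i) s0) //.
  by rewrite (psumr_eq0P (P := xpredT) (fun i _ => cm0 i) (etrans (esym Es) s0)) // subr0.
have sp : 0 < s by rewrite lt_def s0 sumr_ge0.
have W (d : I -> R) : (forall i, 0 <= d i) -> \sum_i d i = s -> (forall i, d i != 0 -> c i != 0) ->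
    weights T (fun i => s^-1 * d i).
  move=> d0 ds dc; split=> [i||i]; first by rewrite mulr_ge0 // invr_ge0 ltW.
    by rewrite -mulr_sumr ds mulVf.
  by rewrite mulf_eq0 negb_or => /andP[_ /dc/cT].
have wp : weights T (fun i => s^-1 * cp i).
  by apply: W => // i; apply: contra => /eqP c_0; rewrite /cp c_0 maxxx.
have wm : weights T (fun i => s^-1 * cm i).
  by apply: W => // i; apply: contra => /eqP c_0; rewrite /cm c_0 oppr0 maxxx.
have := inj wp wm; rewrite /bary.
under eq_bigr do rewrite -scalerA.
under [X in _ = X -> _]eq_bigr do rewrite -scalerA.
rewrite -!scaler_sumr Eq => /(_ erefl) H i.
by have /mulfI := H i; rewrite invr_eq0 => /(_ s0) E; rewrite cpE E subrr.
Qed.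

(** A last coordinate 1 turns affine independence into linear independence of the rows of [Q]; a
    right inverse of [Q] then solves the interpolation, its last row giving the translation. *)
Lemma affine_interp k (v : I -> 'rV[R]_k) :
  exists (M : 'M[R]_(m, k)) (c : 'rV[R]_k), forall i, i \in T -> q i *m M + c = v i.
Proof.
pose Q : 'M[R]_(#|T|, m + 1) := \matrix_(j < #|T|) row_mx (q (enum_val j)) (const_mx 1).
pose V : 'M[R]_(#|T|, k) := \matrix_(j < #|T|) v (enum_val j).
have freeQ : row_free Q.
  apply: inj_row_free => u uQ.
  pose c i := \sum_(j < #|T| | enum_val j == i) u 0 j.
  have cval (j : 'I_#|T|) : c (enum_val j) = u 0 j.
    rewrite /c (bigD1 j) //= big1 ?addr0 // => j' /andP[/eqP /enum_val_inj ->].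
    by rewrite eqxx.
  have csum l (F : I -> 'rV[R]_l) : \sum_i c i *: F i = \sum_j u 0 j *: F (enum_val j).
    rewrite (partition_big (fun j : 'I_#|T| => enum_val j) predT) //=.
    by apply: eq_bigr => i _; rewrite scaler_suml; apply: eq_bigr => j /eqP->.
  have uQ' : u *m Q = row_mx (\sum_i c i *: q i) (\sum_i c i *: const_mx 1).
    rewrite !csum mulmx_sum_row.
    under eq_bigr do rewrite rowK scale_row_mx.
    by elim/big_rec3: _ => [|j y1 y2 y3 _ ->]; rewrite ?row_mx0 // add_row_mx.
  have [cq0 c0] : \sum_i c i *: q i = 0 /\ \sum_i c i *: (const_mx 1 : 'rV[R]_1) = 0.
    by move: uQ'; rewrite uQ -row_mx0 => /esym /eq_row_mx.
  have cz := @aff_indep c _ _ cq0.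
  apply/rowP => j; rewrite -cval cz ?mxE //.
    move=> i; apply: contraR => iT; rewrite /c big1 // => j' /eqP E.
    by move: iT; rewrite -E enum_valP.
  move/rowP/(_ 0): c0; rewrite summxE [RHS]mxE.
  by under eq_bigr do rewrite !mxE mulr1.
exists (usubmx (pinvmx Q *m V)), (dsubmx (pinvmx Q *m V)) => i iT.
have QV : Q *m (pinvmx Q *m V) = V by rewrite mulmxA mulmxVp // mul1mx.
have := congr1 (row (enum_rank_in iT i)) QV.
rewrite row_mul !rowK enum_rankK_in // => <-.
rewrite -[in RHS](vsubmxK (pinvmx Q *m V)) mul_row_col; congr (_ + _).
apply/rowP => l; rewrite !mxE big_ord1 !mxE mul1r.
by rewrite (ord1 (Ordinal _)).
Qed.

Lemma simplex_polyhedral : polyhedral_set (simplex q T).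
Proof.
pose N := #|I|.
have [M [c MC]] := affine_interp (fun i => delta_mx 0 (enum_rank i) : 'rV[R]_N).
pose Q : 'M[R]_(N, m) := \matrix_(j < N) q (enum_val j).
have Mbary w : weights T w -> bary q w *m M + c = \row_j w (enum_val j).
  move=> [w0 w1 wT]; rewrite bary_affine //.
  rewrite (eq_bary (q' := fun i => delta_mx 0 (enum_rank i))); last by move=> i /wT /MC.
  apply/rowP => j; rewrite summxE mxE (bigD1 (enum_val j)) //= !mxE enum_valK !eqxx mulr1.
  rewrite big1 ?addr0 // => i ij; rewrite !mxE eqxx /=.
  case: eqP => [E|_]; last by rewrite mulr0.
  by move: ij; rewrite E enum_rankK eqxx.
(* The interpolating map sends vertices to unit vectors, hence reads off barycentric coordinates.
   The conditions are: coordinates nonnegative, zero off [T], of sum 1, and reproducing [x]; the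
   last one confines [x] to the affine hull. *)
have -> : simplex q T =
  [set x | [set z : 'rV[R]_N | forall j, 0 <= z 0 j] (x *m M + c)] `&`
  ([set x | [set z : 'rV[R]_N | forall j, if enum_val j \in T then True else z 0 j <= 0] (x *m M + c)] `&`
  ([set x | [set (1 : R)%:M] (x *m (M *m const_mx 1) + c *m const_mx 1)] `&`
  [set x | [set 0] (x *m (M *m Q - 1%:M) + c *m Q)])).
  apply/seteqP; split=> x /=.
    case=> w wT ->; rewrite mulmxBr mulmx1 !mulmxA [_ - _ + _]addrAC -!mulmxDl !(Mbary _ wT).
    case: wT => w0 w1 wT; split=> [j|]; first by rewrite mxE.
    split=> [j|]; first by rewrite mxE; case: ifPn => // nT; case: eqVneq (wT (enum_val j)) nT => [->|_ ->].
    split.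
      apply/rowP => j; rewrite (ord1 j) !mxE eqxx mulr1n -[RHS]w1.
      rewrite [RHS](reindex (fun j : 'I_N => enum_val j)) /=; last by apply: onW_bij; exact: enum_val_bij.
      by apply: eq_bigr => k _; rewrite !mxE mulr1.
    apply/eqP; rewrite subr_eq0; apply/eqP.
    rewrite mulmx_sum_row /bary [RHS](reindex (fun j : 'I_N => enum_val j)) /=; last by apply: onW_bij; exact: enum_val_bij.
    by apply: eq_bigr => k _; rewrite rowK mxE.
  rewrite mulmxBr mulmx1 !mulmxA [_ - _ + _]addrAC -!mulmxDl; set z := x *m M + c.
  move=> [z0 [zT [z1 /eqP]]]; rewrite subr_eq0 => /eqP zx.
  exists (fun i => z 0 (enum_rank i)).
    split=> [i||i]; first exact: z0.
      move/rowP/(_ 0): z1; rewrite !mxE eqxx mulr1n => z1.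
      rewrite -[RHS]z1 [LHS](reindex (fun j : 'I_N => enum_val j)) /=; last by apply: onW_bij; exact: enum_val_bij.
      by apply: eq_bigr => k _; rewrite !mxE mulr1 enum_valK.
    apply: contraR => iT; have := zT (enum_rank i); rewrite enum_rankK (negbTE iT) => h.
    by rewrite eq_le h z0.
  rewrite -[LHS]zx mulmx_sum_row /bary [RHS](reindex (fun j : 'I_N => enum_val j)) /=; last by apply: onW_bij; exact: enum_val_bij.
  by apply: eq_bigr => k _; rewrite rowK enum_valK.
apply: polyhedral_setI; [|apply: polyhedral_setI; [|apply: polyhedral_setI]]; apply: polyhedral_preim.
- by apply: polyhedral_forall => j; apply: polyhedral_coordge.
- apply: polyhedral_forall => j; case: (enum_val j \in T); last exact: polyhedral_coord.
  exact: polyhedral_setT.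
- exact: polyhedral_point.
- exact: polyhedral_point.
Qed.

End AffineIndependence.

Lemma simplex_bounded m (q : I -> 'rV[R]_m) T : Defs.bounded_set (simplex q T).
Proof.
exists (\sum_i \sum_j `|q i 0 j|) => _ [w [w0 w1 wT] ->] j.
rewrite summxE; apply: le_trans (ler_norm_sum _ _ _) _; apply: ler_sum => i _.
rewrite mxE normrM; apply: (@le_trans _ _ `|q i 0 j|).
  rewrite ler_piMl // ger0_norm // -w1 (bigD1 i) //= lerDl; exact: sumr_ge0.
by rewrite (bigD1 j) //= lerDl; apply: sumr_ge0.
Qed.

End Simplices.

(** * Simplicial complexes whose simplices are the cliques of a relation *)

Section CliqueComplex.
Variables (R : realType) (I : finType) (e : rel I) (m : nat) (q : I -> 'rV[R]_m).
Implicit Types (w : I -> R) (T : {set I}).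

(** The case [i = j] is included: an index not related to itself is no vertex, which
    [slab_comparable] uses to restrict the vertex set. *)
Definition clique T := [forall i in T, forall j in T, e i j].

Lemma cliqueP T : reflect (forall i j, i \in T -> j \in T -> e i j) (clique T).
Proof.
apply: (iffP forall_inP) => [H i j iT jT|H i iT]; first exact: (forall_inP (H i iT)).
by apply/forall_inP => j jT; apply: H.
Qed.

Definition clique_weights w := exists2 T, clique T & weights T w.

Lemma clique_weightsP w :
  clique_weights w <->
  [/\ forall i, 0 <= w i, \sum_i w i = 1 & forall i j, w i != 0 -> w j != 0 -> e i j].
Proof.
split=> [[T /cliqueP eT [w0 w1 wT]]|[w0 w1 we]].
  by split=> // i j /wT iT /wT jT; apply: eT.
exists (finset (fun i => w i != 0)).
  by apply/cliqueP => i j; rewrite !finset.inE; apply: we.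
by split=> // i; rewrite finset.inE.
Qed.

Definition clique_cells : set (set 'rV[R]_m) := [set P | exists2 T, clique T & P = simplex q T].

Lemma clique_supportP y :
  cplx_support clique_cells y <-> exists2 w, clique_weights w & y = bary q w.
Proof.
split=> [[P [T eT ->] [w wT ->]]|[w [T eT wT] ->]].
  by exists w => //; exists T.
by exists (simplex q T); [exists T|exists w].
Qed.

Hypothesis inj : forall w w', clique_weights w -> clique_weights w' ->
  bary q w = bary q w' -> w =1 w'.

Let injT T : clique T ->
  forall w w', weights T w -> weights T w' -> bary q w = bary q w' -> w =1 w'.
Proof. by move=> eT w w' wT w'T; apply: inj; exists T. Qed.

Lemma cliqueS T T' : (forall i, i \in T' -> i \in T) -> clique T -> clique T'.
Proof. by move=> s /cliqueP eT; apply/cliqueP => i j /s iT /s jT; apply: eT. Qed.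

(** A weighted mean of values at most [b] equals [b] only if every value of nonzero weight does, so
    a supporting hyperplane cuts out the simplex on the vertices it contains. The empty face is the
    simplex on no vertices. *)
Lemma simplex_face T G : clique T -> face (simplex q T) G ->
  exists2 T', clique T' & G = simplex q T'.
Proof.
move=> eT [->|[->|[u [b [_ [_ [Tb ->]]]]]]]; last 1 first.
- exists (finset (fun i => (i \in T) && (dotv u (q i) == b))).
    by apply: (cliqueS _ eT) => i; rewrite finset.inE => /andP[].
  have Tq i : i \in T -> dotv u (q i) <= b.
    by move=> iT; apply: Tb; exists (vertex_weight R i); [apply: weights_vertex|rewrite bary_vertex].
  apply/seteqP; split=> y /=.
    move=> [[w [w0 w1 wT] ->]]; rewrite dotv_sumr => E.
    exists w => //; split=> // i wi; rewrite finset.inE wT //=.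
    have nn k : true -> 0 <= w k * (b - dotv u (q k)).
      move=> _; have [->|/wT kT] := eqVneq (w k) 0; first by rewrite mul0r.
      by rewrite mulr_ge0 // subr_ge0 Tq.
    have z : \sum_k w k * (b - dotv u (q k)) = 0.
      under eq_bigr do rewrite mulrBr.
      by rewrite sumrB -mulr_suml w1 mul1r E subrr.
    have /eqP := psumr_eq0P nn z (isT : xpredT i).
    by rewrite mulf_eq0 (negbTE wi) subr_eq0 eq_sym.
  move=> [w [w0 w1 wT] ->]; split.
    by exists w => //; split=> // i /wT; rewrite finset.inE => /andP[].
  rewrite dotv_sumr -[RHS]mul1r -w1 mulr_suml; apply: eq_bigr => i _.
  by have [->|/wT] := eqVneq (w i) 0; rewrite ?mul0r // finset.inE => /andP[_ /eqP->].
- exists (finset (fun=> false)); first by apply/cliqueP => i j; rewrite finset.inE.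
  apply/seteqP; split=> // y [w [_ w1 wT] _].
  move: w1; rewrite big1 => [/eqP|i _]; first by rewrite eq_sym oner_eq0.
  by apply/eqP; apply: contraT => /wT; rewrite finset.inE.
- by exists T.
Qed.

(** The supporting functional comes from the affine function that is 0 at the vertices shared with
    [T'] and -1 at the other vertices of [T]: by injectivity of weights, a point of the first
    simplex lies in the second exactly when its weights off [T'] vanish. *)
Lemma simplex_interface T T' : clique T -> clique T' ->
  face (simplex q T) (simplex q T `&` simplex q T').
Proof.
move=> eT eT'; have [[y Ty]|] := pselect (simplex q T `&` simplex q T' !=set0); last first.
  by move=> /nonemptyPn ->; left.
right; have [sT|/forall_inPn[k kT kT']] := boolP [forall i in T, i \in T'].
  left; apply/seteqP; split=> x [] // w wT ->; split; first by exists w.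
  by exists w => //; apply: weightsS wT => i iT; exact: (forall_inP sT).
right.
have [M [c Mc]] := affine_interp (injT eT) (fun i => (if i \in T' then 0 else -1)%:M : 'rV[R]_1).
pose u := M^T.
have uE x : (x *m M + c) 0 0 = dotv u x + c 0 0.
  by rewrite mxE /dotv mxE; congr (_ + _); apply: eq_bigr => i _; rewrite mxE mulrC.
have uq i : i \in T -> dotv u (q i) = (if i \in T' then 0 else -1) - c 0 0.
  by move=> iT; apply/eqP; rewrite eq_sym subr_eq eq_sym -uE Mc // !mxE eqxx mulr1n.
have uw w : weights T w -> dotv u (bary q w) = - c 0 0 - \sum_(i | i \notin T') w i.
  move=> [w0 w1 wT]; rewrite dotv_sumr.
  rewrite (eq_bigr (fun i => w i * - c 0 0 - (if i \notin T' then w i else 0))) => [|i _].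
    by rewrite sumrB -mulr_suml w1 mul1r -big_mkcond.
  have [->|/wT iT] := eqVneq (w i) 0; first by rewrite !mul0r if_same subr0.
  by rewrite uq //; case: ifP => _ /=; rewrite mulrBr ?mulr0 ?mulrN1; lra.
have pos w : weights T w -> 0 <= \sum_(i | i \notin T') w i by case=> w0 _ _; apply: sumr_ge0.
have key w : weights T w -> dotv u (bary q w) = - c 0 0 <-> simplex q T' (bary q w).
  move=> wT; split.
    rewrite uw // => E; have z : \sum_(i | i \notin T') w i = 0 by lra.
    exists w => //; case: wT => w0 w1 wT; split=> // i; apply: contraR => iT'.
    by rewrite (psumr_eq0P _ z).
  case=> w' w'T' /inj E; rewrite uw // big1 ?subr0 // => i iT'; rewrite E; try by [exists T|exists T'].
  by case: w'T' => _ _ w'T; apply/eqP; apply: contraR iT' => /w'T.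
exists u, (- c 0 0); split.
  (* The functional takes different values at [q k] and at the common point [y]. *)
  apply: contraTneq isT => u0.
  case: Ty => -[w wT yw] Ty'; have := uq k kT; rewrite (negbTE kT').
  have := (key w wT).2; rewrite -yw => /(_ Ty'); rewrite u0 !dotv0l => <-; lra.
case: Ty => -[w wT yw] Ty'; split.
  by exists y; split; [exists w|rewrite yw; apply/key => //; rewrite -yw].
split.
  by move=> x [w' w'T ->]; rewrite uw // gerBl pos.
apply/seteqP; split=> x /= => [[[w' w'T ->]]|[[w' w'T ->]]] H; split; try by [exists w'].
  exact/key.
by apply/key.
Qed.

Lemma clique_cells_polytopal : polytopal_complex clique_cells.
Proof.
have poly P : clique_cells P -> polyhedral_set P.
  by move=> [T eT ->]; apply: simplex_polyhedral; apply: injT.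
split; last by move=> P CP; split; [exact: poly|case: CP => T _ ->; exact: simplex_bounded].
split; [|split; [exact: poly|split]].
- apply: (@sub_finite_set _ _ (range (simplex q))); last exact: finite_image.
  by move=> P [T _ ->]; exists T.
- by move=> _ G [T eT ->] /(simplex_face eT)[T' eT' ->]; exists T'.
- move=> _ _ [T eT ->] [T' eT' ->]; split; first exact: simplex_interface.
  by rewrite setIC; apply: simplex_interface.
Qed.

(** A point determines its weights, so images of vertices extend to a map affine on every simplex;
    its values off the support are irrelevant. *)
Lemma simplicial_map k (v : I -> 'rV[R]_k) :
  exists f, PL_map (cplx_support clique_cells) f /\
    forall w, clique_weights w -> f (bary q w) = bary v w.
Proof.
have [y|f fP] := @choice 'rV[R]_m 'rV[R]_k
    (fun y z => forall w, clique_weights w -> y = bary q w -> z = bary v w).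
  have [[w ew yw]|no] := pselect (exists2 w, clique_weights w & y = bary q w).
    exists (bary v w) => w' ew' yw'; have E : w =1 w' by apply: inj; rewrite -?yw.
    by apply: eq_bigr => i _; rewrite E.
  by exists 0 => w ew yw; case: no; exists w.
exists f; split; last by move=> w ew; apply: fP.
exists #|{set I}|, (fun i => if clique (enum_val i) then simplex q (enum_val i) else set0).
split; [|split].
- move=> i; case: ifP => eT; last exact: polyhedral_set0.
  exact: simplex_polyhedral (injT eT).
- apply/seteqP; split=> y.
    by case=> _ [T eT ->] Ty; exists (enum_rank T) => //=; rewrite enum_rankK eT.
  by case=> i _ /=; case: ifP => // eT Ty; exists (simplex q (enum_val i)) => //; exists (enum_val i).
- move=> i; case: ifP => eT; last by exists 0, 0.
  have [M [c Mc]] := affine_interp (injT eT) v.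
  exists M, c => _ [w wT ->]; rewrite (fP _ w) //; last by exists (enum_val i).
  case: wT => w0 w1 wT; rewrite bary_affine //; apply: eq_bary => j /wT jT.
  by rewrite Mc.
Qed.

End CliqueComplex.

(** * A calculus of piecewise linear maps *)

Section PiecewiseLinear.
Variable R : realType.

Lemma PL_mapI (k m : nat) (J : finType) (P : J -> set 'rV[R]_k) (A : set 'rV[R]_k)
    (f : 'rV[R]_k -> 'rV[R]_m) :
  (forall j, polyhedral_set (P j)) -> (forall x, A x <-> exists j, P j x) ->
  (forall j, exists (M : 'M[R]_(k, m)) (w : 'rV[R]_m), forall x, P j x -> f x = x *m M + w) ->
  PL_map A f.
Proof.
move=> polyP AP fP; exists #|J|, (fun i => P (enum_val i)); split; [|split] => //.
apply/seteqP; split=> x => [/AP[j Pj]|[i _ Pi]]; last by apply/AP; exists (enum_val i).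
by exists (enum_rank j) => //=; rewrite enum_rankK.
Qed.

Lemma PL_ext k m (A : set 'rV[R]_k) (f g : 'rV[R]_k -> 'rV[R]_m) :
  (forall x, A x -> f x = g x) -> PL_map A f -> PL_map A g.
Proof.
move=> fg [N [P [polyP [AP fP]]]]; exists N, P; split; [|split] => // i.
have [M [w H]] := fP i; exists M, w => x Px; rewrite -fg ?H // AP; by exists i.
Qed.

(** Here [f] serves as a certificate that [A] is a finite union of polyhedral sets; on such a set
    every affine map is PL. *)
Lemma PL_affine k m l (A : set 'rV[R]_k) (f : 'rV[R]_k -> 'rV[R]_m)
    (M : 'M[R]_(k, l)) (c : 'rV[R]_l) :
  PL_map A f -> PL_map A (fun x => x *m M + c).
Proof.
move=> [N [P [polyP [AP fP]]]]; exists N, P; split; [|split] => // i.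
by exists M, c.
Qed.

Lemma PL_id k : PL_map [set: 'rV[R]_k] id.
Proof.
exists 1%N, (fun=> setT); split; [|split]; first by move=> _; exact: polyhedral_setT.
  by apply/seteqP; split=> // x _; exists 0.
by move=> _; exists 1%:M, 0 => x _; rewrite mulmx1 addr0.
Qed.

(** The pieces are those of [f] intersected with preimages of the pieces of [g], taken under the
    affine formula of [f], which is defined everywhere. *)
Lemma PL_comp k m l (A : set 'rV[R]_k) (B : set 'rV[R]_m) (f : 'rV[R]_k -> 'rV[R]_m)
    (g : 'rV[R]_m -> 'rV[R]_l) :
  PL_map A f -> PL_map B g -> (forall x, A x -> B (f x)) -> PL_map A (fun x => g (f x)).
Proof.
move=> [N [P [polyP [-> fP]]]] [N' [Q [polyQ [-> gQ]]]] AB.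
have [M MP] := choice fP; have [c cP] := choice MP.
apply: (@PL_mapI _ _ ('I_N * 'I_N')%type (fun j => P j.1 `&` [set x | Q j.2 (x *m M j.1 + c j.1)])).
- by move=> [i j] /=; apply: polyhedral_setI => //; apply: polyhedral_preim.
- move=> x; split=> [Ax|[[i j] /= [Pi _]]]; last by exists i.
  have [j _ Qj] := AB x Ax; case: Ax => i _ Pi.
  by exists (i, j); split=> //=; rewrite -(cP i).
- move=> [i j] /=; have [M' [c' H]] := gQ j; exists (M i *m M'), (c i *m M' + c') => x [Pi Qj].
  by rewrite (cP i) // H // mulmxDl mulmxA addrA.
Qed.

Lemma PL_restrict k m l (A : set 'rV[R]_k) (f : 'rV[R]_k -> 'rV[R]_m)
    (g : 'rV[R]_k -> 'rV[R]_l) (Q : set 'rV[R]_l) :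
  PL_map A f -> PL_map A g -> polyhedral_set Q -> PL_map (A `&` [set x | Q (g x)]) f.
Proof.
move=> [N [P [polyP [AP fP]]]] [N' [P' [polyP' [AP' gP]]]] polyQ.
have [M MP] := choice gP; have [c cP] := choice MP.
apply: (@PL_mapI _ _ ('I_N * 'I_N')%type
  (fun j => P j.1 `&` (P' j.2 `&` [set x | Q (x *m M j.2 + c j.2)]))).
- move=> [i j] /=; apply: polyhedral_setI => //; apply: polyhedral_setI => //.
  exact: polyhedral_preim.
- move=> x; split=> [[Ax /= Qx]|[[i j] /= [Pi [Pj Qx]]]]; last first.
    by split; [rewrite AP; exists i|rewrite /= (cP j)].
  have := Ax; rewrite AP => -[i _ Pi]; move: Ax; rewrite AP' => -[j _ Pj].
  by exists (i, j) => /=; rewrite -(cP j).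
- by move=> [i j] /=; have [M' [c' H]] := fP i; exists M', c' => x [/H].
Qed.

Lemma PL_pair k m l (A : set 'rV[R]_k) (f : 'rV[R]_k -> 'rV[R]_m) (g : 'rV[R]_k -> 'rV[R]_l) :
  PL_map A f -> PL_map A g -> PL_map A (fun x => row_mx (f x) (g x)).
Proof.
move=> [N [P [polyP [AP fP]]]] [N' [P' [polyP' [AP' gP]]]].
apply: (@PL_mapI _ _ ('I_N * 'I_N')%type (fun j => P j.1 `&` P' j.2)).
- by move=> [i j] /=; apply: polyhedral_setI.
- move=> x; split=> [Ax|[[i j] /= [Pi _]]]; last by rewrite AP; exists i.
  have := Ax; rewrite AP => -[i _ Pi]; move: Ax; rewrite AP' => -[j _ Pj].
  by exists (i, j).
- move=> [i j] /=; have [M1 [c1 H1]] := fP i; have [M2 [c2 H2]] := gP j.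
  exists (row_mx M1 M2), (row_mx c1 c2) => x [/H1-> /H2->].
  by rewrite mul_mx_row add_row_mx.
Qed.

Lemma PL_preim k m l p (A : set 'rV[R]_k) (f : 'rV[R]_k -> 'rV[R]_l)
    (M : 'M[R]_(m, k)) (c : 'rV[R]_k) (M' : 'M[R]_(m, p)) (c' : 'rV[R]_p) :
  PL_map A f -> PL_map [set z | A (z *m M + c)] (fun z => z *m M' + c').
Proof.
move=> [N [P [polyP [-> fP]]]].
apply: (@PL_mapI _ _ 'I_N (fun i => [set z | P i (z *m M + c)])).
- by move=> i; apply: polyhedral_preim.
- by move=> x; split=> [[i _ Pi]|[i Pi]]; exists i.
- by move=> i; exists M', c'.
Qed.

Lemma affine_continuous k m (M : 'M[R]_(k, m)) (c : 'rV[R]_m) :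
  continuous (fun x : 'rV[R]_k => x *m M + c).
Proof.
move=> x; apply: (cvg_rV (nbhs_filter x)) => i.
have E y : (y *m M + c) 0 i = dotv (col i M)^T y + c 0 i.
  rewrite mxE mxE /dotv; congr (_ + _); apply: eq_bigr => j _.
  by rewrite !mxE mulrC.
under eq_fun do rewrite E.
by rewrite E; apply: cvgD; [apply: dotv_continuous|apply: cvg_cst].
Qed.

Lemma PL_continuous k m (A : set 'rV[R]_k) (f : 'rV[R]_k -> 'rV[R]_m) :
  PL_map A f -> {within A, continuous f}.
Proof.
move=> [N [P [polyP [-> fP]]]].
rewrite (_ : \bigcup_(i in setT) P i = \bigcup_(i in [set i | xpredT i]) P i); last first.
  by apply/seteqP; split=> x [i _ Pi]; exists i.
apply: within_bigcup_continuous => i; first exact: polyhedral_closed.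
move=> _; have [M [c H]] := fP i.
have cont : {within P i, continuous (fun x => x *m M + c)}.
  by apply: continuous_subspaceT; apply: affine_continuous.
apply: (subspace_eq_continuous _ cont) => x /set_mem Px.
exact: (esym (H x Px)).
Qed.

Lemma PL_homeoI k m (A : set 'rV[R]_k) (B : set 'rV[R]_m) f g :
  PL_map A f -> PL_map B g -> (forall x, A x -> B (f x)) -> (forall y, B y -> A (g y)) ->
  (forall x, A x -> g (f x) = x) -> (forall y, B y -> f (g y) = y) -> PL_homeo A B f.
Proof.
move=> fA gB fAB gBA gf fg; split=> //; split; first exact: PL_continuous.
split; last by exists g; split=> //; split=> //; exact: PL_continuous.
apply/seteqP; split=> [_ [x Ax <-]|y By]; first exact: fAB.
by exists (g y); [apply: gBA|apply: fg].
Qed.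

End PiecewiseLinear.

(** * Iterated coning from apexes and the weights of a point *)

Section ApexSystem.
Variables (R : realType) (n : nat) (I : finType) (L : I -> seq ('rV[R]_n * R)).
Variables (p : I -> 'rV[R]_n) (rk : I -> nat).

Local Notation B i := (hpoly (L i)).
Local Notation bd i := (rbd (L i) (p i)).
Local Notation gg i := (gauge (L i) (p i)).
Local Notation ex i := (exit_pt (L i) (p i)).

(* [x] lies on the apex-free part of the boundary of [B i] iff [bd i x];
   the unique [i] with [B i x] and [~~ bd i x] is the carrier of [x]. *)
Record apex_system : Prop := ApexSystem {
  apex_in : forall i, B i (p i);
  apex_rank : forall i j, B i (p j) -> j != i -> (rk j < rk i)%N;
  apex_base : forall i j x, B i x -> B j x -> B i (p j) -> j != i -> bd i x;
  apex_star : forall i j x t, B i x -> ~~ bd i x -> B j x -> 0 <= t ->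
    B i (p i + t *: (x - p i)) -> B j (p i + t *: (x - p i));
  apex_descend : forall i x, B i x -> bd i x -> exists2 j, (rk j < rk i)%N & B j x }.

Hypothesis sys : apex_system.

(** Cliques of this relation play the role of chains: by [clique_top] the piece of the member of
    greatest rank contains all apexes of the clique. *)
Definition apex_comparable : rel I := fun i j => `[< B i (p j) >] || `[< B j (p i) >].

Definition carrier x i := B i x /\ ~~ bd i x.

Lemma carrier_exists i x : B i x -> exists j, carrier x j.
Proof.
elim: (rk i).+1 {-2}i (ltnSn (rk i)) => // k IH {}i ik ix.
have [/(apex_descend sys ix)[j ji jx]|nb] := boolP (bd i x); last by exists i.
by apply: (IH j) => //; apply: leq_trans ji _.
Qed.

Lemma carrier_apex i j x : carrier x i -> B j x -> B j (p i).
Proof.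
move=> [ix nb] jx; have := apex_star sys ix nb jx (lexx 0).
by rewrite scale0r addr0; apply; apply: apex_in.
Qed.

Lemma carrier_unique i j x : carrier x i -> carrier x j -> i = j.
Proof.
move=> ci cj; apply/eqP; apply: contraT => ij; case: (cj) => jx /negP; case.
by apply: (apex_base sys jx ci.1 _ ij); apply: (carrier_apex ci).
Qed.

(** The exit point has gauge 1, so it is on the boundary of [B i] and its carrier is not [i]; the
    apex of that carrier lies in [B i], which makes its rank smaller. *)
Lemma exit_carrier i x : B i x -> gg i x != 0 ->
  [/\ B i (ex i x) & exists j, [/\ carrier (ex i x) j, (rk j < rk i)%N & B i (p j)]].
Proof.
move=> ix g0; have ey : B i (ex i x) by apply: exit_pt_in => //; apply: apex_in.
split=> //; have [j cj] := carrier_exists ey; exists j.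
have ipj := carrier_apex cj ey; split=> //; apply: (apex_rank sys ipj).
apply: contraTneq isT => E; case: cj => _; rewrite E.
by rewrite (proj1 (gauge_rbd _ ey)) // gauge_exit.
Qed.

(** The argument [k] is fuel. Each round gives the carrier its share and passes to the exit point,
    whose carrier has smaller rank, so by [wt_stable] every [k] above the rank of the carrier gives
    the same weights. *)
Fixpoint wt (k : nat) (x : 'rV[R]_n) : I -> R :=
  if k is k'.+1 then
    if [pick i | `[< carrier x i >]] is Some i then
      fun j => (1 - gg i x) * (j == i)%:R + gg i x * wt k' (ex i x) j
    else fun=> 0
  else fun=> 0.

Lemma wtS k x i j : carrier x i ->
  wt k.+1 x j = (1 - gg i x) * (j == i)%:R + gg i x * wt k (ex i x) j.
Proof.
move=> ci /=; case: pickP => [i' /asboolP ci'|/(_ i)/asboolP//].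
by rewrite (carrier_unique ci ci').
Qed.

Lemma wt_stable k k' x i : carrier x i -> (rk i < k)%N -> (rk i < k')%N -> wt k x =1 wt k' x.
Proof.
elim: k k' x i => // k IH [|k'] // x i ci ik ik' j; rewrite !(wtS _ _ ci).
have [->|g0] := eqVneq (gg i x) 0; first by rewrite !mul0r.
have [_ [l [cl li _]]] := exit_carrier ci.1 g0.
by rewrite (IH k' _ l) //; apply: leq_trans li _.
Qed.

Let top_rank := (\max_i rk i).+1.

Let rk_lt i : (rk i < top_rank)%N.
Proof. by rewrite ltnS; apply: leq_bigmax. Qed.

Definition apex_weight x := wt top_rank x.

(** The recursion holds for every piece containing [x], not only for the carrier: on the boundary
    the gauge is 1 and the exit point is [x] itself. This one formula on a whole closed piece is
    what the continuity proof uses. *)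
Lemma apex_weightE i x j : B i x ->
  apex_weight x j = (1 - gg i x) * (j == i)%:R + gg i x * apex_weight (ex i x) j.
Proof.
move=> ix; have [b|nb] := boolP (bd i x).
  have g1 : gg i x = 1 by apply/gauge_rbd.
  by rewrite exit_pt_id // g1 subrr mul0r add0r mul1r.
rewrite /apex_weight {1}/top_rank (wtS _ _ (conj ix nb)).
have [->|g0] := eqVneq (gg i x) 0; first by rewrite !mul0r.
have [_ [l [cl li _]]] := exit_carrier ix g0.
by congr (_ + _ * _); apply: (wt_stable cl) => //; apply: leq_trans li _; rewrite -ltnS; apply: rk_lt.
Qed.

Lemma gauge_bounds i x : B i x -> 0 <= gg i x <= 1.
Proof. by move=> ix; rewrite gauge_ge0 gauge_le1. Qed.

Lemma apex_weightP i x : B i x ->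
  [/\ clique_weights apex_comparable (apex_weight x) &
      forall i' j, B i' x -> apex_weight x j != 0 -> B i' (p j)].
Proof.
move=> /carrier_exists[{}i ci].
elim: (rk i).+1 {-2}i (ltnSn (rk i)) x ci => // k IH {}i ik x ci; have ix := ci.1.
have /andP[g0 g1] := gauge_bounds ix.
have wE j := apex_weightE j ix.
have [gz|gnz] := eqVneq (gg i x) 0.
  have {}wE j : apex_weight x j = (j == i)%:R by rewrite wE gz subr0 mul0r mul1r addr0.
  split; last first.
    move=> i' j ix'; rewrite wE; have [-> _|] := eqVneq j i; last by rewrite eqxx.
    exact: carrier_apex ci ix'.
  apply/clique_weightsP; split=> [j||j l].
  - by rewrite wE.
  - under eq_bigr do rewrite wE.
    by rewrite (bigD1 i) //= eqxx big1 ?addr0 // => j /negbTE->.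
  - rewrite !wE; have [->|] := eqVneq j i; last by rewrite eqxx.
    have [-> _ _|] := eqVneq l i; last by rewrite eqxx.
    by apply/orP; left; apply/asboolP; apply: apex_in.
have [iy [l [cl li _]]] := exit_carrier ix gnz.
have [//|/clique_weightsP[w0 w1 we] wB] := IH l _ _ cl; first exact: leq_trans li _.
have supp j : apex_weight x j != 0 -> j = i \/ apex_weight (ex i x) j != 0.
  rewrite wE; have [|ji] := eqVneq j i; first by left.
  by rewrite mulr0 add0r mulf_eq0 negb_or => /andP[_]; right.
split; last first.
  move=> i' j ix' /supp[->|/wB]; first exact: carrier_apex ci ix'.
  (* The exit point is on the ray from [p i] through [x]; the star condition, with the inverse gauge
     as parameter, keeps it in [B i']. *)
  apply; apply: (apex_star sys ix ci.2 ix') => //.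
  by rewrite invr_ge0.
apply/clique_weightsP; split=> [j||j j'].
- by rewrite wE addr_ge0 // mulr_ge0 // subr_ge0.
- under eq_bigr do rewrite wE.
  rewrite big_split -!mulr_sumr w1 (bigD1 i) //= eqxx big1 ?addr0 => [|j /negbTE->//].
  by rewrite !mulr1 subrK.
- move=> /supp[->|wj] /supp[->|wj'].
  + by apply/orP; left; apply/asboolP; apply: apex_in.
  + by apply/orP; left; apply/asboolP; apply: wB.
  + by apply/orP; right; apply/asboolP; apply: wB.
  + exact: we.
Qed.

Lemma clique_top (w : I -> R) : clique_weights apex_comparable w ->
  exists2 i, w i != 0 & forall j, w j != 0 -> B i (p j).
Proof.
move/clique_weightsP=> [w0 w1 we].
have [|i0 /andP[_ wi0]] := psumr_neq0P (P := xpredT) (fun i _ => w0 i).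
  by rewrite w1; apply/eqP; rewrite oner_eq0.
have wi0' : w i0 != 0 by rewrite gt_eqF.
case: (arg_maxnP rk (i0 := i0) (P := fun i => w i != 0)) => // i wi imax.
exists i => // j wj; have /orP[/asboolP//|/asboolP jpi] := we i j wi wj.
have [->|ji] := eqVneq j i; first exact: apex_in.
by have := apex_rank sys jpi; rewrite eq_sym => /(_ ji); rewrite ltnNge (imax j wj : (rk j <= rk i)%N).
Qed.

Lemma bary_in i (w : I -> R) : (forall j, 0 <= w j) -> \sum_j w j = 1 ->
  (forall j, w j != 0 -> B i (p j)) -> B i (bary p w).
Proof. exact: hpoly_sum. Qed.

(** Remove the top vertex [i] and renormalise the rest by [mu]. The remaining barycenter lies in a
    smaller piece, hence on the boundary of [B i], so it is the exit point and [mu] is the gauge;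
    then induct on rank. *)
Lemma apex_weight_bary (w : I -> R) : clique_weights apex_comparable w -> apex_weight (bary p w) =1 w.
Proof.
move=> cw; have [i wi iB] := clique_top cw; move/clique_weightsP: cw => [w0 w1 we].
elim: (rk i).+1 {-2}i (ltnSn (rk i)) w wi iB w0 w1 we => // k IH {}i ik w wi iB w0 w1 we.
have ix : B i (bary p w) by apply: bary_in.
have wsum : \sum_(j | j != i) w j = 1 - w i by rewrite -w1 [X in _ = X - _](bigD1 i) //= addrAC subrr add0r.
pose mu := 1 - w i; have mu0 : 0 <= mu by rewrite /mu -wsum; apply: sumr_ge0.
have bE : bary p w = p i + (\sum_(j | j != i) w j *: p j - mu *: p i).
  by rewrite /bary (bigD1 i) //= /mu scalerBl scale1r opprB [RHS]addrCA [p i + _]addrC subrK addrC.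
have [muz|munz] := eqVneq mu 0.
  have wz j : j != i -> w j = 0.
    by move=> ji; apply: (psumr_eq0P (P := fun j => j != i)) => //; rewrite wsum.
  have -> : bary p w = p i.
    rewrite bE muz scale0r subr0 big1 ?addr0 // => j /wz->; exact: scale0r.
  have gz : gg i (p i) = 0.
    by have := gauge_scale (L i) (p i) (p i) (lexx 0); rewrite scale0r addr0 mul0r.
  move=> j; rewrite (apex_weightE _ (@apex_in sys i)) gz subr0 mul1r mul0r addr0.
  by have [->|/wz->] := eqVneq j i; rewrite //=; move: muz; rewrite /mu; lra.
have mup : 0 < mu by rewrite lt_def munz.
pose w' j := if j == i then 0 else w j / mu.
have w'w j : w' j != 0 -> j != i /\ w j != 0.
  by rewrite /w'; case: (j == i); rewrite ?eqxx // mulf_eq0 negb_or => /andP[].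
have w'0 j : 0 <= w' j by rewrite /w'; case: ifP => // _; rewrite divr_ge0.
have w'1 : \sum_j w' j = 1.
  rewrite (bigD1 i) //= /w' eqxx add0r.
  under eq_bigr => j ji do rewrite (negbTE ji).
  by rewrite -mulr_suml wsum divff.
have w'e j l : w' j != 0 -> w' l != 0 -> apex_comparable j l.
  by move=> /w'w[_ wj] /w'w[_ wl]; apply: we.
have cw' : clique_weights apex_comparable w' by apply/clique_weightsP.
have bE' : bary p w = p i + mu *: (bary p w' - p i).
  rewrite bE scalerBr; congr (_ + (_ - _)).
  rewrite /bary [in RHS](bigD1 i) //= /w' eqxx scale0r add0r scaler_sumr.
  by apply: eq_bigr => j ji; rewrite (negbTE ji) scalerA mulrCA divff // mulr1.
have [l w'l lB] := clique_top cw'; have [li wl] := w'w _ w'l.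
have ll : (rk l < rk i)%N by apply: (apex_rank sys (iB l wl)).
have iy : B i (bary p w') by apply: bary_in => // j /w'w[_ /iB].
have ly : B l (bary p w') by apply: bary_in.
have g1 : gg i (bary p w') = 1.
  apply/gauge_rbd => //.
  exact: (apex_base sys iy ly (iB l wl) li).
have yE := IH l (leq_trans ll ik) w' w'l lB w'0 w'1 w'e.
move=> j; rewrite (apex_weightE _ ix) bE' gauge_scale // g1 mulr1 exit_pt_scale // yE /w' /mu.
have [->|ji] := eqVneq j i; first by rewrite mulr0 addr0 mulr1; lra.
by rewrite mulr0 add0r mulrCA divff // mulr1.
Qed.

Lemma apex_bary_inj (w w' : I -> R) : clique_weights apex_comparable w -> clique_weights apex_comparable w' ->
  bary p w = bary p w' -> w =1 w'.
Proof. by move=> cw cw' E j; rewrite -(apex_weight_bary cw) E apex_weight_bary. Qed.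

Definition apex_support : set 'rV[R]_n := [set x | exists i, B i x].

Lemma apex_weight_bounds x j : apex_support x -> 0 <= apex_weight x j <= 1.
Proof.
move=> [i ix]; have [/clique_weightsP[w0 w1 _] _] := apex_weightP ix.
by rewrite w0 /= -w1 (bigD1 j) //= lerDl; apply: sumr_ge0.
Qed.

(** Induction on rank, pasting over the closed pieces; on each piece the recursion expresses the
    weight through the gauge and the weight at the exit point. *)
Lemma apex_weight_continuous j : {within apex_support, continuous (apex_weight^~ j)}.
Proof.
suff H k : {within \bigcup_(i in [set i | (rk i < k)%N]) B i, continuous (apex_weight^~ j)}.
  rewrite (_ : apex_support = \bigcup_(i in [set i | (rk i < top_rank)%N]) B i) //.
  by apply/seteqP; split=> x => [[i ix]|[i _ ix]]; exists i => //; apply: rk_lt.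
elim: k => [|k IH]; first by rewrite bigcup0 //; apply: continuous_subspace0.
apply: within_bigcup_continuous => [i|i]; first exact: hpoly_closed.
rewrite ltnS => ik; apply/subspace_continuousP => x ix.
have FF : Filter (within (B i) (nbhs x)) by apply: within_filter; apply: nbhs_filter.
have gc : gg i y @[y --> within (B i) (nbhs x)] --> gg i x.
  by apply: (@cvg_within_filter _ _ _ _ (nbhs_filter x)); apply: gauge_continuous.
(* With gauge 0 at [x] the exit points nearby may diverge, but the weights differ from those of
   [p i] by at most the gauge. *)
have [gz|gnz] := eqVneq (gg i x) 0.
  have wE y : apex_weight y j - (j == i)%:R = gg i y * (apex_weight (ex i y) j - (j == i)%:R)
      \/ ~ B i y.
    have [iy|niy] := pselect (B i y); last by right.
    by left; rewrite (apex_weightE _ iy); lra.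
  apply/cvgrPdist_lt => e e0.
  have : \forall y \near within (B i) (nbhs x), gg i y < e.
    by apply: (cvgr_lt (gg i x)) => //; rewrite gz.
  rewrite !near_withinE; apply: filterS => y H iy.
  rewrite /from_subspace (apex_weightE j ix) gz subr0 mul1r mul0r addr0 distrC.
  have [->|//] := wE y; rewrite normrM (ger0_norm (gauge_ge0 _ _ _)).
  have := H iy; have [->|gy _] := eqVneq (gg i y) 0; first by rewrite mul0r.
  apply: le_lt_trans (H iy); rewrite ler_piMr ?gauge_ge0 //.
  have [ey _] := exit_carrier iy gy.
  have /andP[a0 a1] : 0 <= apex_weight (ex i y) j <= 1 by apply: apex_weight_bounds; exists i.
  by rewrite ler_norml; case: (j == i) => /=; lra.
have exc : ex i y @[y --> within (B i) (nbhs x)] --> ex i x.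
  apply: cvg_rV => l; rewrite /exit_pt !mxE.
  under eq_fun do rewrite !mxE.
  have cl : y 0 l @[y --> within (B i) (nbhs x)] --> x 0 l.
    by apply: (@cvg_within_filter _ _ _ _ (nbhs_filter x)); apply: coord_continuous.
  apply: cvgD; first exact: cvg_cst.
  by apply: cvgM; [exact: cvgV|apply: cvgB => //; exact: cvg_cst].
have gn : \forall y \near within (B i) (nbhs x), gg i y != 0.
  have : \forall y \near within (B i) (nbhs x), 0 < gg i y.
    by apply: (cvgr_gt (gg i x)) => //; rewrite lt_def gnz gauge_ge0.
  by apply: filterS => y; rewrite lt_def => /andP[].
(* With nonzero gauge the exit map is continuous at [x] and lands in pieces of smaller rank, where
   the induction hypothesis applies. *)
have wex : apex_weight (ex i y) j @[y --> within (B i) (nbhs x)] --> apex_weight (ex i x) j.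
  have [_ [l [cl li _]]] := exit_carrier ix gnz.
  have Ux : (\bigcup_(i in [set i | (rk i < k)%N]) B i) (ex i x).
    by exists l; [exact: leq_trans li ik|case: cl].
  have /subspace_continuousP/(_ _ Ux) := IH.
  apply: cvg_comp => V; rewrite /= !nbhs_simpl /=.
  move=> /exc HV; move: HV gn; rewrite /= !near_withinE.
  move=> H; apply: (@filterS2 _ _ (nbhs_filter x) _ _ _ _ H) => y H1 H2 iy; apply: (H1 iy).
  have [_ [l' [cl' li' _]]] := exit_carrier iy (H2 iy).
  by exists l'; [exact: leq_trans li' ik|case: cl'].
have : (1 - gg i y) * (j == i)%:R + gg i y * apex_weight (ex i y) j
    @[y --> within (B i) (nbhs x)] --> apex_weight x j.
  rewrite (apex_weightE _ ix); apply: cvgD; last exact: cvgM.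
  by apply: cvgM; [apply: cvgB => //; exact: cvg_cst|exact: cvg_cst].
apply: cvg_trans; apply: near_eq_cvg.
by rewrite near_withinE; apply: nearW => y iy; rewrite /from_subspace (apex_weightE _ iy).
Qed.

End ApexSystem.

(** * The retraction onto the simplices and its straight-line homotopy *)

Section ApexRetraction.
Variables (R : realType) (n : nat) (I : finType) (L : I -> seq ('rV[R]_n * R)).
Variables (p : I -> 'rV[R]_n) (rk : I -> nat).
Hypothesis sys : apex_system L p rk.

Local Notation W := (apex_weight L p rk).
Local Notation D := (clique_cells (apex_comparable L p) p).

Definition apex_retract x := bary p (W x).

(** A straight segment suffices: all apexes with weight at [x] lie in every piece containing [x],
    and pieces are convex. *)
Definition apex_homotopy (x : 'rV[R]_n) (t : R) := x + t *: (apex_retract x - x).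

Lemma apex_retract_in i x : hpoly (L i) x -> hpoly (L i) (apex_retract x).
Proof.
move=> ix; have [/clique_weightsP[w0 w1 _] wB] := apex_weightP sys ix.
by apply: bary_in => // j; apply: wB.
Qed.

Lemma apex_retract_id y : cplx_support D y -> apex_retract y = y.
Proof.
move=> /clique_supportP[w cw ->]; apply: eq_bigr => i _.
by rewrite apex_weight_bary.
Qed.

Lemma apex_cells_sub y : cplx_support D y -> apex_support L y.
Proof.
move=> /clique_supportP[w cw ->]; have [i _ iB] := clique_top sys cw.
by move/clique_weightsP: cw => [w0 w1 _]; exists i; apply: bary_in.
Qed.

Lemma apex_retract_cells x : apex_support L x -> cplx_support D (apex_retract x).
Proof.
move=> [i ix]; have [cw _] := apex_weightP sys ix.
by apply/clique_supportP; exists (W x).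
Qed.

Lemma apex_deformation :
  strong_deformation_retraction (apex_support L) (cplx_support D) apex_homotopy.
Proof.
split; [|split; [|split; [|split]]].
- apply/subspace_continuousP => -[x t] [/= Xx _].
  set S := [set _ | _]; pose Fi := within S (nbhs (x, t)).
  have FF : Filter Fi by apply: within_filter; apply: nbhs_filter.
  have c1 : z.1 @[z --> Fi] --> x.
    by apply: (@cvg_within_filter _ _ _ _ (nbhs_filter (x, t))); apply: cvg_fst.
  have c2 : z.2 @[z --> Fi] --> t.
    by apply: (@cvg_within_filter _ _ _ _ (nbhs_filter (x, t))); apply: cvg_snd.
  have cW j : W z.1 j @[z --> Fi] --> W x j.
    have /subspace_continuousP/(_ _ Xx) := @apex_weight_continuous _ _ _ _ _ _ sys j.
    apply: cvg_comp => V /= HV.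
    have : \forall z \near Fi, apex_support L z.1 -> V z.1 by exact: (c1 _ HV).
    rewrite /Fi !near_withinE; apply: (@filterS _ _ (nbhs_filter (x, t))) => z H zS.
    by apply: H => //; case: zS.
  rewrite /from_subspace /=; apply: cvg_rV => i.
  rewrite /apex_homotopy /apex_retract /bary.
  under eq_fun do rewrite !mxE summxE.
  rewrite !mxE summxE.
  have cx : (fun z : 'rV[R]_n * R => z.1 0 i) @ Fi --> x 0 i.
    exact: (@cvg_comp _ _ _ (fun z : 'rV[R]_n * R => z.1) (fun y : 'rV[R]_n => y 0 i) _ _ _ c1 (@coord_continuous _ 1 n 0 i x)).
  apply: cvgD => //; apply: cvgM => //; apply: cvgB => //.
  apply: (@cvg_big _ _ (fun u v : R => u + v)) => //; first exact: add_continuous.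
  by move=> j _; under eq_fun do rewrite mxE; rewrite mxE; apply: cvgM => //; exact: cvg_cst.
- move=> x t [i ix] t01; exists i; apply: hpoly_comb => //; exact: apex_retract_in.
- by move=> x _; rewrite /apex_homotopy scale0r addr0.
- by move=> x Xx; rewrite /apex_homotopy scale1r addrC subrK; apply: apex_retract_cells.
- by move=> y t Dy _; rewrite /apex_homotopy apex_retract_id // subrr scaler0 addr0.
Qed.

End ApexRetraction.

(** * Relative interiors of polyhedra *)

Section RelativeInterior.
Variables (R : realType) (n : nat).
Implicit Types (L : seq ('rV[R]_n * R)) (x y : 'rV[R]_n).

(** The relative interior read off a presentation: constraints that are equalities on the whole
    polyhedron are exempt. *)
Definition relint L x :=
  hpoly L x /\ forall h, h \in L -> (exists2 y, hpoly L y & dotv h.1 y < h.2) -> dotv h.1 x < h.2.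

Lemma relint_nonempty L : hpoly L !=set0 -> exists x, relint L x.
Proof.
move=> [x0 Lx0].
suff H (s : seq ('rV[R]_n * R)) : exists2 x, hpoly L x & forall h, h \in s ->
    (exists2 y, hpoly L y & dotv h.1 y < h.2) -> h \in L -> dotv h.1 x < h.2.
  by have [x Lx xs] := H L; exists x; split=> // h hL hy; apply: xs.
elim: s => [|h s [x Lx xs]]; first by exists x0.
have [[y Ly hy]|no] := pselect (exists2 y, hpoly L y & dotv h.1 y < h.2); last first.
  by exists x => // h'; rewrite inE => /orP[/eqP->//|/xs].
exists (x + 2^-1 *: (y - x)); first by apply: hpoly_comb => //; lra.
move=> h'; rewrite inE dotv_comb => /orP[/eqP-> _ hL|h's yy h'L].
  by have := Lx _ hL; lra.
by have := xs _ h's yy h'L; have := Ly _ h'L; lra.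
Qed.

Lemma relint_seg L x y t : relint L x -> hpoly L y -> 0 <= t < 1 -> relint L (x + t *: (y - x)).
Proof.
move=> [Lx xs] Ly /andP[t0 t1]; split; first by apply: hpoly_comb => //; lra.
by move=> h hL yy; rewrite dotv_comb; have := xs h hL yy; have := Ly h hL; nra.
Qed.

(** A constraint that grows when moving away from [y] is strict at [y], hence has slack at [x];
    finitely many slacks leave a common step. *)
Lemma relint_extend L x y : relint L x -> hpoly L y ->
  exists2 e, 0 < e & hpoly L (x + e *: (x - y)).
Proof.
move=> [Lx xs] Ly.
suff H (s : seq ('rV[R]_n * R)) : exists2 e, 0 < e & forall h, h \in s -> h \in L ->
    dotv h.1 (x + e *: (x - y)) <= h.2.
  by have [e e0 es] := H L; exists e => // h hL; apply: es.
elim: s => [|h s [e e0 es]]; first by exists 1.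
have E h' c : dotv h' (x + c *: (x - y)) = dotv h' x + c * (dotv h' x - dotv h' y).
  by rewrite dotvDr dotvZr dotvBr.
have [hL|hL] := boolP (h \in L); last first.
  by exists e => // h'; rewrite inE => /orP[/eqP-> hL'|/es//]; rewrite hL' in hL.
have [d d0 dh] : exists2 d, 0 < d & dotv h.1 x + d * (dotv h.1 x - dotv h.1 y) <= h.2.
  have hx := Lx h hL; have hy := Ly h hL.
  have [le|gt] := leP (dotv h.1 x) (dotv h.1 y); first by exists 1 => //; lra.
  have hxs : dotv h.1 x < h.2 by apply: xs => //; exists y => //; lra.
  exists ((h.2 - dotv h.1 x) / (dotv h.1 x - dotv h.1 y)); first by rewrite divr_gt0 // subr_gt0.
  by rewrite divfK; [lra|rewrite subr_eq0 gt_eqF].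
exists (Num.min d e); first by rewrite lt_min d0.
have le1 : Num.min d e <= d by rewrite ge_min lexx.
have le2 : Num.min d e <= e by rewrite ge_min lexx orbT.
have m0 : 0 < Num.min d e by rewrite lt_min d0.
set c := Num.min d e in le1 le2 m0 *.
have K h' f : 0 < f -> c <= f -> h' \in L -> dotv h'.1 x + f * (dotv h'.1 x - dotv h'.1 y) <= h'.2 ->
    dotv h'.1 x + c * (dotv h'.1 x - dotv h'.1 y) <= h'.2.
  move=> f0 cf /Lx hx hf; have [le|gt] := leP (dotv h'.1 x) (dotv h'.1 y); nra.
move=> h'; rewrite inE E => /orP[/eqP-> _|h's h'L]; first exact: K dh.
by apply: (K _ e) => //; rewrite -E; apply: es.
Qed.

(** If a functional is maximal at [x], moving slightly past [x] away from [y] cannot increase it, so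
    it is maximal at [y] too. *)
Lemma relint_face L x G : relint L x -> face (hpoly L) G -> G x -> G = hpoly L.
Proof.
move=> xs [->//|[->//|[u [c [_ [_ [uc ->]]]]]]] [Lx ux].
apply/seteqP; split=> [y []//|y Ly]; split=> //=.
have [e e0 Le] := relint_extend xs Ly; have := uc _ Le; have := uc _ Ly.
by rewrite dotvDr dotvZr dotvBr ux; nra.
Qed.

Lemma gauge0_ray L p x t : hpoly L p -> hpoly L x -> gauge L p x = 0 -> 0 <= t ->
  hpoly L (p + t *: (x - p)).
Proof.
move=> Lp Lx g0 t0 h hL; rewrite dotv_comb.
have hp := Lp h hL; have hx := Lx h hL.
have [hs|hs] := boolP (strict_at p h); last first.
  by move: hs; rewrite /strict_at -leNgt; nra.
by have := gauge_ge x hL hs; rewrite g0 mul0r; nra.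
Qed.

End RelativeInterior.

(** * Finite complexes of nonempty cells and the crossing of the slab *)

Section Cells.
Variables (R : realType) (n : nat) (X : finType) (Lc : X -> seq ('rV[R]_n * R)).
Local Notation r s := (hpoly (Lc s)).

Record cell_complex : Prop := CellComplex {
  cell_inj : injective (fun s => hpoly (Lc s));
  cell_nonempty : forall s, r s !=set0;
  cell_face : forall s G, G !=set0 -> face (r s) G -> exists t, r t = G;
  cell_meet : forall s t, face (r s) (r s `&` r t) }.

Hypothesis cplx : cell_complex.

(** A substitute for the dimension: it grows strictly with inclusion. *)
Definition cell_rank s := #|[pred t | `[< r t `<=` r s >]]|.

Lemma cell_rank_lt s t : r t `<=` r s -> t != s -> (cell_rank t < cell_rank s)%N.
Proof.
move=> ts tns; apply: proper_card; apply/properP; split.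
  by apply/fintype.subsetP => u; rewrite !inE => ut x /ut/ts.
exists s; rewrite unfold_in /=; first exact/asboolP.
apply/asboolP => st; case/eqP: tns; apply: (cell_inj cplx).
by apply/seteqP; split.
Qed.

Lemma relint_sub s t x : relint (Lc s) x -> r t x -> r s `<=` r t.
Proof.
move=> xs tx; have E := relint_face xs (@cell_meet cplx s t) (conj xs.1 tx).
by move=> y; rewrite -E => -[].
Qed.

Lemma relint_uniq s t x : relint (Lc s) x -> r t x -> r t `<=` r s -> t = s.
Proof.
move=> xs tx ts; apply: (cell_inj cplx); apply/seteqP; split=> //.
exact: relint_sub xs tx.
Qed.

Lemma not_relint s x : r s x -> ~ relint (Lc s) x ->
  exists h, [/\ h \in Lc s, dotv h.1 x = h.2 & exists2 y, r s y & dotv h.1 y < h.2].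
Proof.
move=> sx nrel; apply: contrapT => no; apply: nrel; split=> // h hL yy.
rewrite lt_neqAle sx // andbT; apply/eqP => hx; apply: no; by exists h.
Qed.

Lemma relint_or_subcell s x : r s x ->
  relint (Lc s) x \/ exists t, [/\ r t x, r t `<=` r s & t != s].
Proof.
move=> sx; have [|nrel] := pselect (relint (Lc s) x); [by left|right].
have [h [hL hx [y sy hy]]] := not_relint sx nrel.
(* A constraint tight at [x] but not on the whole cell cuts out a proper face through [x]. *)
have [||t tE] := @cell_face cplx s (r s `&` [set z | dotv h.1 z = h.2]).
- by exists x.
- right; right; exists h.1, h.2; split.
    by apply: contraTneq isT => h0; move: hx hy; rewrite h0 !dotv0l => ->; rewrite ltxx.
  split; first by exists x.
  by split=> // z sz; apply: sz.
exists t; rewrite tE; split; [by []|by move=> z []|].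
apply: contraTneq isT => ts; have : r t y by rewrite ts.
by rewrite tE => -[_ /= hy']; move: hy; rewrite hy' ltxx.
Qed.


(* Walking from a relatively interior point in a direction that decreases [F]
   either leaves the cell through a smaller cell of the slab or never stops. *)
Lemma cell_crossing_low (F : 'rV[R]_n -> R) (a b : R) :
  (forall s, exists u v, forall x, r s x -> F x = dotv u x + v) ->
  (forall s v, a <= v <= b -> ~ (forall x, r s x -> F x = v)) ->
  forall s x, r s x -> a <= F x <= b -> exists2 y, r s y & F y < a.
Proof.
move=> Faff nflat s.
elim: (cell_rank s).+1 {-2}s (ltnSn (cell_rank s)) => // k IH {}s sk x sx Fx.
apply: contrapT => no.
have Fa y : r s y -> a <= F y by move=> sy; rewrite leNgt; apply/negP => Fy; apply: no; exists y.
(* Otherwise [y] lies in a smaller cell, which by induction already goes below [a]. *)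
have slab_relint y : r s y -> a <= F y <= b -> relint (Lc s) y.
  move=> sy Fy; have [//|[t [ty ts tns]]] := relint_or_subcell sy.
  have [|z tz Fz] := IH t _ y ty Fy; first exact: leq_trans (cell_rank_lt ts tns) _.
  by case: no; exists z => //; apply: ts.
have xs := slab_relint x sx Fx.
have [u [v Fuv]] := Faff s.
have Fc y e : r s y -> r s (x + e *: (y - x)) -> F (x + e *: (y - x)) = F x + e * (F y - F x).
  by move=> sy sye; rewrite !Fuv // dotv_comb; lra.
(* Non-flatness provides another level; if that level is higher, move past [x] away from it. *)
have [z sz Fz] : exists2 z, r s z & F z < F x.
  have [y [sy Fy]] : exists y, r s y /\ F y != F x.
    apply: contrapT => noy; apply: (nflat s (F x) Fx) => y sy; apply/eqP.
    by apply: contrapT => /negP ny; apply: noy; exists y.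
  have [lt|ge] := ltP (F y) (F x); first by exists y.
  have [e e0 se] := relint_extend xs sy.
  have E : x + e *: (x - y) = x + (- e) *: (y - x) by rewrite scaleNr -scalerN opprB.
  exists (x + e *: (x - y)) => //; rewrite E Fc -?E //.
  have : F x < F y by rewrite lt_neqAle eq_sym Fy.
  nra.
have [g0|g0] := eqVneq (gauge (Lc s) x z) 0.
  have ray t : 0 <= t -> r s (x + t *: (z - x)) by apply: gauge0_ray.
  (* At this parameter the ray would be at level [a - 1]. *)
  pose t := (F x - a + 1) / (F x - F z).
  have d0 : 0 < F x - F z by rewrite subr_gt0.
  have t0 : 0 <= t by apply: divr_ge0; [have := Fa x sx; lra|exact: ltW].
  have := Fa _ (ray t t0); rewrite Fc //; last exact: ray.
  have : t * (F x - F z) = F x - a + 1 by rewrite /t divfK // gt_eqF.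
  nra.
(* The exit point is still in the slab, hence relatively interior; but a constraint strict at [x] is
   tight there. *)
have sy := exit_pt_in sx sz; set y := exit_pt _ _ _ in sy.
have Fy : F y = F x + (gauge (Lc s) x z)^-1 * (F z - F x) by rewrite /y Fc.
have gi : 0 < (gauge (Lc s) x z)^-1 by rewrite invr_gt0 lt_def g0 gauge_ge0.
have [|_ ys] := slab_relint y sy.
  by rewrite Fa //=; move: Fx => /andP[_]; nra.
have /(gauge_rbd _ sy)/hasP[h hL /andP[hs /eqP hy]] := gauge_exit g0.
by have := ys h hL (ex_intro2 _ _ x sx hs); rewrite hy ltxx.
Qed.

End Cells.

(** * The pieces below and above [a] form an apex system *)

Section Labels.
Variables (R : realType) (n : nat) (X : finType) (Lc : X -> seq ('rV[R]_n * R)).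
Variables (A : X -> 'rV[R]_n * R) (F : 'rV[R]_n -> R) (a b : R).
Local Notation r s := (hpoly (Lc s)).

Record transversal_cells : Prop := TransversalCells {
  tc_cplx : cell_complex Lc;
  tc_affine : forall s x, r s x -> F x = dotv (A s).1 x + (A s).2;
  tc_nonflat : forall s v, a <= v <= b -> ~ (forall x, r s x -> F x = v) }.

Hypothesis tc : transversal_cells.
Let cplx : cell_complex Lc. Proof. exact: tc_cplx tc. Qed.
Hypothesis ab : a < b.

Definition slab s := exists2 x, r s x & a <= F x <= b.

Lemma slab_low s : slab s -> exists2 y, r s y & F y < a.
Proof.
move=> [x sx Fx]; apply: (cell_crossing_low cplx _ (tc_nonflat tc)) sx Fx => t.
by exists (A t).1, (A t).2; apply: tc_affine.
Qed.

Lemma slab_high s : slab s -> exists2 y, r s y & b < F y.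
Proof.
move=> [x sx Fx].
have [t|t v vab H||y sy Fy] := @cell_crossing_low _ _ _ _ cplx (fun x => - F x) (- b) (- a) _ _ s x sx.
- exists (- (A t).1), (- (A t).2) => y ty.
  by rewrite (tc_affine tc ty) dotvNl opprD.
- apply: (tc_nonflat tc (s := t) (v := - v)); first by lra.
  by move=> y ty; rewrite -(H y ty) opprK.
- by lra.
- by exists y => //; lra.
Qed.

Lemma F_comb s x y t : r s x -> r s y -> r s (x + t *: (y - x)) ->
  F (x + t *: (y - x)) = F x + t * (F y - F x).
Proof. by move=> sx sy sz; rewrite !(tc_affine tc (s := s)) // dotv_comb; lra. Qed.

Lemma not_slab s : ~ slab s -> (forall x, r s x -> F x < a) \/ (forall x, r s x -> b < F x).
Proof.
have ab' := ab.
move=> ns; have out x : r s x -> F x < a \/ b < F x.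
  move=> sx; have [Fa|Fa] := ltP (F x) a; first by left.
  by have [Fb|Fb] := ltP b (F x); [right|case: ns; exists x; rewrite // Fa].
have [x0 sx0] := @cell_nonempty _ _ _ _ cplx s.
have mixed x y : r s x -> r s y -> F x < a -> b < F y -> False.
  move=> sx sy Fx Fy.
  have d : 0 < F y - F x by lra.
  have d0 : 0 <= a - F x by lra.
  have d1 : a - F x <= F y - F x by lra.
  pose t := (a - F x) / (F y - F x).
  have tE : t * (F y - F x) = a - F x by rewrite /t divfK // gt_eqF.
  have t0 : 0 <= t by apply: divr_ge0 => //; apply: ltW.
  have t1 : t <= 1 by rewrite ler_pdivrMr // mul1r.
  clearbody t.
  have sz : r s (x + t *: (y - x)) by apply: hpoly_comb => //; rewrite t0.
  apply: ns; exists (x + t *: (y - x)) => //; rewrite (F_comb sx sy sz) tE; lra.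
have [Fx0|Fx0] := out _ sx0; [left|right] => x sx; have [Fx|Fx] := out _ sx => //.
  by case: (mixed x0 x).
by case: (mixed x x0).
Qed.

(** Start at a relatively interior point and move towards a point beyond level [c], available
    because the cell crosses both ends of the slab; stopping short of that point preserves relative
    interiority. *)
Lemma slab_apex s c : slab s -> a <= c <= b -> exists2 p, relint (Lc s) p & F p = c.
Proof.
have ab' := ab.
move=> ss cab; have [p ps] := relint_nonempty (@cell_nonempty _ _ _ _ cplx s).
have key y : r s y -> (c - F p) * (c - F y) < 0 -> exists2 p, relint (Lc s) p & F p = c.
  move=> sy neg; pose t := (c - F p) / (F y - F p).
  have d : F y - F p != 0 by rewrite subr_eq0; apply: contraTneq neg => ->; rewrite -leNgt -expr2 sqr_ge0.
  have tE : t * (F y - F p) = c - F p by rewrite /t divfK.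
  clearbody t; have t01 : 0 <= t < 1.
    have D2 : 0 < (F y - F p) ^+ 2 by rewrite exprn_even_gt0.
    have : 0 < t * (1 - t) * (F y - F p) ^+ 2.
      have -> : t * (1 - t) * (F y - F p) ^+ 2 =
        (t * (F y - F p)) * ((F y - F p) - t * (F y - F p)) by ring.
      by rewrite tE; nra.
    by rewrite pmulr_lgt0 // => t1; apply/andP; split; nra.
  have ts := relint_seg ps sy t01; exists (p + t *: (y - p)) => //.
  by rewrite (F_comb ps.1 sy ts.1) tE; lra.
have [lt|gt|eq] := ltgtP (F p) c; last by exists p.
  by have [y sy Fy] := slab_high ss; apply: (key y sy); nra.
by have [y sy Fy] := slab_low ss; apply: (key y sy); nra.
Qed.

Definition side (k : bool) x := if k then a <= F x else F x <= a.

Definition label_valid (i : X * bool) := `[< exists2 x, r i.1 x & side i.2 x >].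

Local Notation label := {i : X * bool | label_valid i}.

(** Levels are prescribed only for cells meeting the slab; elsewhere any relatively interior point
    will do. *)
Lemma apex_exists (i : X * bool) : exists p, relint (Lc i.1) p /\
  (slab i.1 -> F p = if i.2 then b else a).
Proof.
have ab' := ab.
have [ss|ns] := pselect (slab i.1).
  have cab : a <= (if i.2 then b else a) <= b by case: i.2; lra.
  have [p ps Fp] := slab_apex ss cab.
  by exists p; split.
by have [p ps] := relint_nonempty (@cell_nonempty _ _ _ _ cplx i.1); exists p.
Qed.

Definition apex (i : label) : 'rV[R]_n := projT1 (cid (apex_exists (val i))).

Lemma apex_relint i : relint (Lc (val i).1) (apex i).
Proof. by rewrite /apex; case: cid => p []. Qed.

Lemma apex_slab (i : label) : slab (val i).1 -> F (apex i) = if (val i).2 then b else a.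
Proof. by rewrite /apex; case: cid => p []. Qed.

Definition side_constraint (i : X * bool) : 'rV[R]_n * R :=
  if i.2 then (- (A i.1).1, (A i.1).2 - a) else ((A i.1).1, a - (A i.1).2).

Definition label_cell (i : label) := rcons (Lc (val i).1) (side_constraint (val i)).

Lemma side_constraintP (i : X * bool) x : r i.1 x ->
  (dotv (side_constraint i).1 x <= (side_constraint i).2) <-> side i.2 x.
Proof.
case: i => s k /= sx; rewrite /side /side_constraint (tc_affine tc sx).
by case: k; rewrite /= ?dotvNl; split; lra.
Qed.

Lemma label_cellP i x : hpoly (label_cell i) x <-> r (val i).1 x /\ side (val i).2 x.
Proof.
split=> [Lx|[sx kx] h].
  have sx : r (val i).1 x by move=> h hL; apply: Lx; rewrite mem_rcons inE hL orbT.
  by split=> //; apply/side_constraintP => //; apply: Lx; rewrite mem_rcons inE eqxx.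
by rewrite mem_rcons inE => /orP[/eqP->|/sx//]; apply/side_constraintP.
Qed.


Lemma label_low (i : label) x : ~~ (val i).2 -> ~ slab (val i).1 -> r (val i).1 x -> F x < a.
Proof.
have ab' := ab.
move=> k ns; have [H|H] := not_slab ns; first exact: H.
have /asboolP[y sy] := valP i; rewrite /side (negbTE k).
by have := H y sy => ??; exfalso; lra.
Qed.

Lemma label_high (i : label) x : (val i).2 -> ~ slab (val i).1 -> r (val i).1 x -> b < F x.
Proof.
have ab' := ab.
move=> k ns; have [H|H] := not_slab ns; last exact: H.
have /asboolP[y sy] := valP i; rewrite /side k.
by have := H y sy => ??; exfalso; lra.
Qed.

Lemma apex_label_cell i : hpoly (label_cell i) (apex i).
Proof.
have ab' := ab.
apply/label_cellP; split; first exact: (apex_relint i).1.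
rewrite /side; have [ss|ns] := pselect (slab (val i).1).
  by rewrite apex_slab //; case: (val i).2 => //; apply: ltW.
case: ifPn => k.
  by have := label_high k ns (apex_relint i).1; lra.
exact/ltW/(label_low k ns (apex_relint i).1).
Qed.

Lemma apex_above (i : label) : (val i).2 -> b <= F (apex i).
Proof.
move=> k; have [ss|ns] := pselect (slab (val i).1); first by rewrite apex_slab // k.
exact/ltW/(label_high k ns (apex_relint i).1).
Qed.

(** The facet at level [a] counts for upper pieces, whose apex is strictly above it, but not for
    lower ones: if a lower piece touches level [a], its cell meets the slab and its apex is at level
    [a] as well. *)
Lemma rbd_label i x : hpoly (label_cell i) x ->
  rbd (label_cell i) (apex i) x <-> ~ relint (Lc (val i).1) x \/ ((val i).2 /\ F x = a).
Proof.
have ab' := ab.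
move=> /label_cellP[sx kx]; rewrite /rbd /label_cell has_rcons; split.
  case/orP=> [/andP[hs /eqP hx]|/hasP[h hL /andP[hs /eqP hx]]]; last first.
    left=> -[_ xs].
    by have := xs h hL (ex_intro2 _ _ (apex i) (apex_relint i).1 hs); rewrite hx ltxx.
  right; move: hs hx; have ps := (apex_relint i).1.
  rewrite /strict_at /side_constraint.
  have Fx := tc_affine tc sx; have Fp := tc_affine tc ps.
  case: ifPn => /= k; rewrite ?dotvNl => hs hx; first by split=> //; lra.
  exfalso; have ss : slab (val i).1 by exists x => //; lra.
  by have := apex_slab ss; rewrite (negbTE k); lra.
case=> [nrel|[k Fx]].
  have [h [hL hx yy]] := not_relint sx nrel.
  apply/orP; right; apply/hasP; exists h => //; rewrite hx eqxx andbT.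
  by apply: (apex_relint i).2.
apply/orP; left; have ps := (apex_relint i).1; have := apex_above k.
rewrite /strict_at /side_constraint k /= !dotvNl.
have := tc_affine tc sx; have := tc_affine tc ps => Fp Fx' ge.
by apply/andP; split; [lra|apply/eqP; lra].
Qed.

(** The upper piece of a cell ranks just above the lower one, whose apex it contains, and below both
    pieces of any strictly larger cell. *)
Definition label_rank (i : label) := ((cell_rank Lc (val i).1).*2 + (val i).2)%N.

Lemma label_apex_sub (i j : label) : hpoly (label_cell i) (apex j) ->
  r (val j).1 `<=` r (val i).1 /\ ((val j).2 -> (val i).2).
Proof.
have ab' := ab.
move=> /label_cellP[sp kp]; split; first exact: (relint_sub cplx (apex_relint j) sp).
move=> kj; apply: contraT => ki; move: kp; rewrite /side (negbTE ki).
have := apex_above kj; lra.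
Qed.

Lemma label_ext (i j : label) : (val i).1 = (val j).1 -> (val i).2 = (val j).2 -> i = j.
Proof. by case: i j => [[s k] ?] [[t l] ?] /= st kl; apply: val_inj; rewrite /= st kl. Qed.

Lemma label_apex_system : apex_system label_cell apex label_rank.
Proof.
have ab' := ab.
split.
- exact: apex_label_cell.
- move=> i j /label_apex_sub[sub kk] ji; rewrite /label_rank.
  have [st|st] := eqVneq (val j).1 (val i).1.
    rewrite st; case kj: (val j).2; case ki: (val i).2; rewrite ?addn1 ?addn0 //.
    + by case/eqP: ji; apply: label_ext; rewrite ?kj ?ki.
    + by move: (kk kj); rewrite ki.
    + by case/eqP: ji; apply: label_ext; rewrite ?kj ?ki.
  have := cell_rank_lt cplx sub st; rewrite -leq_double doubleS => H.
  by apply: leq_trans (leq_trans _ H) (leq_addr _ _); case: (val j).2; rewrite ?addn1 ?addn0.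
- move=> i j x ix jx /label_apex_sub[sub kk] ji; apply/rbd_label => //.
  move: ix jx => /label_cellP[sx kx] /label_cellP[tx lx].
  have [st|st] := eqVneq (val j).1 (val i).1; last first.
    by left=> xs; case/eqP: st; apply: (relint_uniq cplx xs tx).
  right; move: kx lx; rewrite /side; case kj: (val j).2; case ki: (val i).2 => // kx lx.
  + by case/eqP: ji; apply: label_ext; rewrite ?kj ?ki.
  + by move: (kk kj); rewrite ki.
  + by split=> //; lra.
  + by case/eqP: ji; apply: label_ext; rewrite ?kj ?ki.
- move=> i j x t ix nb jx t0 iy.
  have xs : relint (Lc (val i).1) x.
    by apply: contrapT => nrel; move/negP: nb; apply; apply/rbd_label => //; left.
  have nFx : (val i).2 -> F x <> a.
    by move=> k Fx; move/negP: nb; apply; apply/rbd_label => //; right.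
  move: ix jx iy => /label_cellP[sx kx] /label_cellP[tx lx] /label_cellP[sy ky].
  apply/label_cellP; split; first exact: (relint_sub cplx xs tx).
  move: kx lx ky nFx; rewrite /side; case kj: (val j).2; case ki: (val i).2 => // kx lx ky nFx.
    (* Lower [i], upper [j]: both [x] and the apex of [i] are at level [a], hence so is the whole
       ray. *)
    have Fx : F x = a by lra.
    have ss : slab (val i).1 by exists x => //; rewrite Fx lexx ltW.
    have := F_comb (apex_relint i).1 sx sy; rewrite (apex_slab ss) ki Fx; lra.
  (* Upper [i], lower [j]: [x] would be at level [a], which is boundary for [i]. *)
  by exfalso; apply: nFx => //; lra.
- move=> i x ix; move/(rbd_label ix); move: ix => /label_cellP[sx kx] [nrel|[k Fx]].
    have [//|[t [tx ts tns]]] := relint_or_subcell cplx sx.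
    have v : label_valid (t, (val i).2) by apply/asboolP; exists x.
    exists (Sub _ v : label); last by apply/label_cellP.
    by rewrite /label_rank /= ltn_add2r ltn_double; apply: (cell_rank_lt cplx ts tns).
  have v : label_valid ((val i).1, false) by apply/asboolP; exists x => //=; rewrite /side Fx.
  exists (Sub _ v : label); first by rewrite /label_rank /= k addn0 addn1.
  by apply/label_cellP; split=> //=; rewrite /side Fx.
Qed.

End Labels.

(** * Levels of [F] under the retraction *)

Section RetractionLevels.
Variables (R : realType) (n : nat) (X : finType) (Lc : X -> seq ('rV[R]_n * R)).
Variables (A : X -> 'rV[R]_n * R) (F : 'rV[R]_n -> R) (a b : R).
Local Notation r s := (hpoly (Lc s)).
Hypothesis (tc : transversal_cells Lc A F a b) (ab : a < b).

Local Notation label := {i : X * bool | label_valid Lc F a i}.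
Local Notation p := (apex tc ab).
Local Notation L := (@label_cell R n X Lc A F a).
Local Notation rk := (@label_rank R n X Lc F a).
Local Notation e := (apex_comparable L p).
Local Notation slab := (slab Lc F a b).
Let sys := label_apex_system tc ab.

Local Notation ret := (apex_retract L p rk).

Lemma label_ex s x : r s x -> forall k, side F a k x -> exists2 i : label, hpoly (L i) x & val i = (s, k).
Proof.
move=> sx k kx; have v : label_valid Lc F a (s, k) by apply/asboolP; exists x.
by exists (Sub _ v); rewrite ?SubK //; apply/(label_cellP tc).
Qed.

Lemma apex_supportP x : apex_support L x <-> exists s, r s x.
Proof.
split=> [[i /(label_cellP tc)[sx _]]|[s sx]]; first by exists (val i).1.
have [Fx|Fx] := leP a (F x).
  by have [i ix _] := label_ex (k := true) sx Fx; exists i.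
by have [i ix _] := label_ex (k := false) sx (ltW Fx); exists i.
Qed.

Lemma retract_side x k : apex_support L x -> side F a k x -> side F a k (ret x).
Proof.
move=> /apex_supportP[s sx] kx; have [i ix iE] := label_ex sx kx.
by have /(label_cellP tc)[_] := apex_retract_in sys ix; rewrite iE.
Qed.

(** Both parts are carried from the exit point, whose carrier has smaller rank, by the conical
    formula [retE]. Above [b] only the bound survives, which is all that superlevel sets require. *)
Lemma retract_level x : apex_support L x ->
  (a <= F x <= b -> F (ret x) = F x) /\ (b <= F x -> b <= F (ret x)).
Proof.
have ab' := ab.
move=> [i0 /(carrier_exists sys)[i ci]].
elim: (rk i).+1 {-2}i (ltnSn (rk i)) x ci => // k IH {}i ik x ci; have ix := ci.1.
have Xx : apex_support L x by exists i.
have /(label_cellP tc)[sx kx] := ix.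
have [Fxa|aFx] := leP (F x) a.
  split=> [/andP[aFx _]|]; last by lra.
  have := retract_side (k := false) Xx Fxa; have := retract_side (k := true) Xx aFx.
  by rewrite /side; lra.
have ki : (val i).2 by case: (val i).2 kx; rewrite /side //; lra.
have ps := (apex_relint tc ab i).1.
have Rx := apex_retract_in sys ix; have /(label_cellP tc)[sRx _] := Rx.
have retE : ret x = p i + gauge (L i) (p i) x *: (ret (exit_pt (L i) (p i) x) - p i).
  rewrite /apex_retract /bary.
  under eq_bigr do rewrite (apex_weightE sys _ ix) scalerDl.
  rewrite big_split /= (bigD1 i) //= eqxx mulr1 big1 => [|j /negbTE->]; last by rewrite mulr0 scale0r.
  under [X in _ + 0 + X]eq_bigr do rewrite -scalerA.
  by rewrite -scaler_sumr addr0 scalerBl scale1r scalerBr addrA addrAC.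
have [g0|g0] := eqVneq (gauge (L i) (p i) x) 0.
  have -> : ret x = p i by rewrite retE g0 scale0r addr0.
  split=> [Fx|_]; last exact: apex_above.
  have ss : slab (val i).1 by exists x.
  have Fp := apex_slab tc ab ss; rewrite ki in Fp.
  rewrite Fp; apply/eqP; rewrite eq_le; apply/andP; split; last by case/andP: Fx.
  rewrite leNgt; apply/negP => Fxb.
  have d : 0 < b - F x by rewrite subr_gt0.
  (* At this parameter the ray from the apex at level [b] would be at level [a - 1], outside the
     upper piece. *)
  pose t := (b - a + 1) / (b - F x).
  have tE : t * (b - F x) = b - a + 1 by rewrite /t divfK // gt_eqF.
  have t0 : 0 <= t by apply: divr_ge0; [rewrite addr_ge0 // subr_ge0 ltW|exact: ltW].
  clearbody t.
  have /(label_cellP tc)[sy] := gauge0_ray (@apex_label_cell _ _ _ _ _ _ _ _ tc ab i) ix g0 t0.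
  rewrite /side ki (F_comb tc ps sx sy) Fp; nra.
have [iy [j [cj ji _]]] := exit_carrier sys ix g0.
have := IH j (leq_trans ji ik) _ cj; have := exit_ptK g0.
have := apex_retract_in sys iy; set y := exit_pt _ _ _ in iy retE *.
have gp : 0 < gauge (L i) (p i) x by rewrite lt_def g0 gauge_ge0.
set g := gauge _ _ _ in gp g0 retE *.
move=> /(label_cellP tc)[sRy _] xE [IH1 IH2].
have /(label_cellP tc)[sy ky] := iy.
have FRx : F (ret x) = F (p i) + g * (F (ret y) - F (p i)).
  by rewrite retE (F_comb tc ps sRy) // -retE.
have Fx : F x = F (p i) + g * (F y - F (p i)) by rewrite -{1}xE (F_comb tc ps sy) // xE.
have aFy : a <= F y by move: ky; rewrite /side ki.
have [ss|ns] := pselect (slab (val i).1); last first.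
  have high z : r (val i).1 z -> b < F z by apply: (label_high tc ab ki ns).
  by split=> [/andP[_ Fxb]|_]; [have := high x sx; lra|exact/ltW/high].
have Fp := apex_slab tc ab ss; rewrite ki in Fp; rewrite Fp in Fx FRx.
split=> [/andP[_ Fxb]|Fxb].
  rewrite FRx IH1 // aFy /=; nra.
have : b <= F (ret y) by apply: IH2; nra.
by rewrite FRx; nra.
Qed.

Lemma F_bary w : clique_weights e w -> F (bary p w) = \sum_i w i * F (p i).
Proof.
move=> cw; have [i _ iB] := clique_top sys cw; move/clique_weightsP: cw => [w0 w1 _].
have sB j : w j != 0 -> r (val i).1 (p j) by move=> /iB/(label_cellP tc)[].
have sb : r (val i).1 (bary p w) by apply: hpoly_sum.
rewrite (tc_affine tc sb) dotv_sumr -[X in _ + X]mul1r -w1 mulr_suml -big_split /=.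
apply: eq_bigr => j _; have [->|/sB sj] := eqVneq (w j) 0; first by rewrite !mul0r addr0.
by rewrite (tc_affine tc sj) mulrDr.
Qed.

Lemma weighted_le w (f : label -> R) c i : (forall j, 0 <= w j) -> \sum_j w j = 1 ->
  (forall j, w j != 0 -> f j <= c) -> w i != 0 -> f i < c -> \sum_j w j * f j < c.
Proof.
move=> w0 w1 fc wi fi; rewrite -[ltRHS]mul1r -w1 mulr_suml (bigD1 i) //= [ltRHS](bigD1 i) //=.
apply: ltr_leD; first by rewrite ltr_pM2l // lt_def wi w0.
apply: ler_sum => j _; have [->|wj] := eqVneq (w j) 0; first by rewrite !mul0r.
by apply: ler_wpM2l => //; apply: fc.
Qed.

(** A label whose cell misses the slab has its apex strictly above [b] or below [a], and
    comparability forces all apexes of the clique weakly to that side, so the mean leaves the slab.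
    Hence the slab part of [D] is a union of whole simplices. *)
Lemma slab_support w : clique_weights e w -> a <= F (bary p w) <= b ->
  forall i, w i != 0 -> slab (val i).1.
Proof.
have ab' := ab.
move=> cw; rewrite (F_bary cw); move/clique_weightsP: cw => [w0 w1 we] /andP[Fa Fb] i wi.
apply: contrapT => ns; have ps := (apex_relint tc ab i).1.
case ki : (val i).2.
  have pib := label_high tc ab ki ns ps.
  have kj j : w j != 0 -> b <= F (p j).
    move=> wj; apply: apex_above.
    have /orP[/asboolP ipj|/asboolP jpi] := we i j wi wj; last exact: (label_apex_sub jpi).2.
    apply: contraT => nj; have /(label_cellP tc)[_] := @apex_label_cell _ _ _ _ _ _ _ _ tc ab j.
    rewrite /side (negbTE nj); move: ipj => /(label_cellP tc)[sp _].
    by have := label_high tc ab ki ns sp; lra.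
  have : - \sum_j w j * F (p j) < - b; last by lra.
  rewrite -sumrN; under eq_bigr do rewrite -mulrN.
  by apply: (weighted_le w0 w1 _ wi) => [j /kj|]; rewrite ?lerN2 ?ltrN2.
move/negbT in ki; have pia := label_low tc ab ki ns ps.
have : \sum_j w j * F (p j) < a; last by lra.
apply: (weighted_le w0 w1 _ wi pia) => j wj.
have /(label_cellP tc)[_] := @apex_label_cell _ _ _ _ _ _ _ _ tc ab j; rewrite /side.
case kj: (val j).2 => // _.
have /orP[/asboolP ipj|/asboolP jpi] := we i j wi wj.
  by move: (label_apex_sub ipj).2; rewrite kj (negbTE ki) => /(_ isT).
by move: jpi => /(label_cellP tc)[_]; rewrite /side kj; lra.
Qed.

End RetractionLevels.

(** * Pushing weights forward along a map of vertices *)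

Section Pushforward.
Variables (R : realType) (I : finType) (h : I -> I).

Definition push_weight (w : I -> R) j := \sum_i w i * (h i == j)%:R.

Lemma push_weight_ge0 w : (forall i, 0 <= w i) -> forall j, 0 <= push_weight w j.
Proof. by move=> w0 j; apply: sumr_ge0 => i _; rewrite mulr_ge0. Qed.

Lemma push_weight_supp w j : push_weight w j != 0 -> exists2 i, w i != 0 & h i = j.
Proof.
move=> nz; apply: contrapT => no; case/eqP: nz; rewrite /push_weight big1 // => i _.
have [hi|] := eqVneq (h i) j; last by rewrite mulr0.
have [->|wi] := eqVneq (w i) 0; first by rewrite mul0r.
by case: no; exists i.
Qed.

Lemma push_weight_bary w m (q : I -> 'rV[R]_m) : bary q (push_weight w) = bary (fun i => q (h i)) w.
Proof.
rewrite /bary; under eq_bigr do rewrite scaler_suml.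
rewrite exchange_big; apply: eq_bigr => i _; rewrite (bigD1 (h i)) //= eqxx mulr1.
rewrite big1 ?addr0 // => j /negbTE hj; rewrite eq_sym hj mulr0 scale0r //.
Qed.

Lemma push_weight_sum w (f : I -> R) : \sum_j push_weight w j * f j = \sum_i w i * f (h i).
Proof.
under eq_bigr do rewrite mulr_suml.
rewrite exchange_big; apply: eq_bigr => i _; rewrite (bigD1 (h i)) //= eqxx mulr1.
rewrite big1 ?addr0 // => j /negbTE hj; rewrite eq_sym hj mulr0 mul0r //.
Qed.

Lemma push_weight_sum1 w : \sum_j push_weight w j = \sum_i w i.
Proof.
have := push_weight_sum w (fun=> 1).
by under eq_bigr do rewrite mulr1; under [in RHS]eq_bigr do rewrite mulr1.
Qed.

End Pushforward.

(* Pouring a total mass [c] into the bins [l] of capacity [z], each bin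
   being filled up before the next one is started. *)
Lemma greedy_fill (R : realType) (I : eqType) (rk : I -> nat) (z : I -> R) (l : seq I) (c : R) :
  uniq l -> pairwise (fun i j => rk j <= rk i)%N l -> (forall i, 0 <= z i) ->
  0 <= c <= \sum_(i <- l) z i ->
  exists u : I -> R, [/\ forall i, 0 <= u i <= z i, forall i, i \notin l -> u i = 0,
    \sum_(i <- l) u i = c &
    forall i j, i \in l -> j \in l -> u i != 0 -> u j != z j -> (rk j <= rk i)%N].
Proof.
move=> + + z0; elim: l c => [|x l IH] c.
  by rewrite !big_nil => _ _ c0; exists (fun=> 0); split=> // [i|]; rewrite ?big_nil ?lexx ?z0 //; lra.
move=> /= /andP[xl ul] /andP[/allP px pl]; rewrite big_cons => cx.
have [cz|zc] := leP c (z x).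
  exists (fun i => if i == x then c else 0); split.
  - by move=> i; case: eqP => [->|_]; [rewrite cz; case/andP: cx => ->|rewrite lexx z0].
  - by move=> i; rewrite inE negb_or => /andP[/negbTE->].
  - rewrite big_cons eqxx big_seq big1 ?addr0 // => i il.
    by case: eqP => // E; rewrite -E il in xl.
  - move=> i j il jl; case: (eqVneq i x) => [->|]; last by rewrite eqxx.
    by move=> _ _; move: jl; rewrite inE => /orP[/eqP->//|/px].
have [|u [u0 ul0 uc uf]] := IH (c - z x) ul pl; first by lra.
exists (fun i => if i == x then z x else u i); split.
- by move=> i; case: eqP => [->|_]; rewrite ?z0 ?lexx ?u0.
- by move=> i; rewrite inE negb_or => /andP[/negbTE-> /ul0].
- have E : \sum_(i <- l) (if i == x then z x else u i) = \sum_(i <- l) u i; last first.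
    by rewrite big_cons eqxx E uc addrC subrK.
  apply: eq_big_seq => i il.
  by case: eqP => // E; rewrite -E il in xl.
- move=> i j; rewrite !inE; case: (eqVneq i x) => [->|ix] /=; case: (eqVneq j x) => [->|jx] //=.
  + by move=> _ /px.
  + by rewrite eqxx.
  + exact: uf.
Qed.

(** * The slab part of [D] as a triangulated prism *)

Section SlabProduct.
Variables (R : realType) (n : nat) (X : finType) (Lc : X -> seq ('rV[R]_n * R)).
Variables (A : X -> 'rV[R]_n * R) (F : 'rV[R]_n -> R) (a b : R).
Local Notation r s := (hpoly (Lc s)).
Hypothesis (tc : transversal_cells Lc A F a b) (ab : a < b).

Local Notation label := {i : X * bool | label_valid Lc F a i}.
Local Notation p := (apex tc ab).
Local Notation L := (@label_cell R n X Lc A F a).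
Local Notation rk := (@label_rank R n X Lc F a).
Local Notation e := (apex_comparable L p).
Local Notation slab := (slab Lc F a b).
Let sys := label_apex_system tc ab.

(** The fallback [i] of [insubd] is never reached for a cell meeting the slab, since both of its
    sides are inhabited. *)
Definition relabel (k : bool) (i : label) : label := insubd i ((val i).1, k).

Lemma relabelE k i : slab (val i).1 -> val (relabel k i) = ((val i).1, k).
Proof.
move=> ss; rewrite val_insubd; case: ifP => // /negP[]; apply/asboolP => /=.
case: k => /=; first by case: ss => x sx /andP[Fa _]; exists x.
by have [x sx Fx] := slab_low tc ss; exists x => //; apply: ltW.
Qed.

Lemma relabel_slab k i : slab (val i).1 -> slab (val (relabel k i)).1.
Proof. by move=> ss; rewrite relabelE. Qed.

Lemma F_apex (i : label) : slab (val i).1 -> F (p i) = if (val i).2 then b else a.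
Proof. exact: apex_slab. Qed.

(** On slab labels the order is the product of inclusion of cells with lower < upper; the chains of
    such a product form the standard triangulation of a prism. *)
Lemma slab_apexP (i j : label) : slab (val j).1 ->
  hpoly (L i) (p j) <-> r (val j).1 `<=` r (val i).1 /\ ((val j).2 -> (val i).2).
Proof.
have ab' := ab; move=> sj; split=> [|[sub kk]]; first exact: label_apex_sub.
apply/(label_cellP tc); split; first exact/sub/(apex_relint tc ab j).1.
rewrite /side F_apex //; case: (val i).2 kk; case: (val j).2 => // kk; last by have := kk isT.
exact: ltW.
Qed.

Definition slab_comparable : rel label := fun i j =>
  [&& e i j, `[< slab (val i).1 >] & `[< slab (val j).1 >]].

Lemma slab_weightsP (w : label -> R) : clique_weights slab_comparable w <->
  clique_weights e w /\ forall i, w i != 0 -> slab (val i).1.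
Proof.
split=> [/clique_weightsP[w0 w1 we]|[/clique_weightsP[w0 w1 we] ws]].
  split; first by apply/clique_weightsP; split=> // i j wi wj; case/and3P: (we i j wi wj).
  by move=> i wi; case/and3P: (we i i wi wi) => _ /asboolP.
apply/clique_weightsP; split=> // i j wi wj; apply/and3P.
by split; [exact: we|apply/asboolP; exact: ws|apply/asboolP; exact: ws].
Qed.

Definition slab_part : set 'rV[R]_n :=
  [set y | cplx_support (clique_cells e p) y /\ a <= F y <= b].

Lemma slab_weights_bounds (w : label -> R) : clique_weights slab_comparable w -> a <= \sum_i w i * F (p i) <= b.
Proof.
have ab' := ab; move=> /slab_weightsP[/clique_weightsP[w0 w1 _] ws].
rewrite -[leLHS]mul1r -[X in _ && (_ <= X)]mul1r -w1 !mulr_suml.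
apply/andP; split; apply: ler_sum => i _; (have [->|/ws/F_apex->] := eqVneq (w i) 0; first by rewrite !mul0r);
  apply: ler_wpM2l => //; case: (val i).2 => //; exact: ltW.
Qed.

Lemma slab_partP y : slab_part y <-> cplx_support (clique_cells slab_comparable p) y.
Proof.
split=> [[/clique_supportP[w cw ->] Fy]|/clique_supportP[w cw ->]].
  apply/clique_supportP; exists w => //; apply/slab_weightsP; split=> //.
  exact: slab_support cw Fy.
have [cw' _] := (slab_weightsP w).1 cw; split; first by apply/clique_supportP; exists w.
by rewrite (F_bary cw'); apply: slab_weights_bounds.
Qed.

(** An upper apex is placed vertically over the lower apex of the same cell, at the height given by
    [F]. *)
Definition prism_vertex i : 'rV[R]_(n + 1) := pt (p (relabel false i)) (F (p i)).
Local Notation Q := prism_vertex.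

Lemma bary_prism (w : label -> R) : bary Q w = pt (bary (fun i => p (relabel false i)) w) (\sum_i w i * F (p i)).
Proof.
rewrite /bary /Q /pt; elim/big_rec3: _ => [|i y1 y2 y3 _ ->].
  by rewrite -[0 in LHS]row_mx0; congr row_mx; apply/rowP => k; rewrite !mxE.
rewrite scale_row_mx add_row_mx; congr row_mx.
by apply/rowP => k; rewrite !mxE.
Qed.

Lemma bottom_weights (w : label -> R) : clique_weights slab_comparable w ->
  clique_weights slab_comparable (push_weight (relabel false) w).
Proof.
move=> /slab_weightsP[/clique_weightsP[w0 w1 we] ws].
have supp j : push_weight (relabel false) w j != 0 ->
    exists2 i, w i != 0 & slab (val i).1 /\ relabel false i = j.
  by move=> /push_weight_supp[i wi <-]; exists i => //; split=> //; apply: ws.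
apply/slab_weightsP; split; last by move=> j /supp[i _ [ss <-]]; apply: relabel_slab.
apply/clique_weightsP; split; [exact: push_weight_ge0|by rewrite push_weight_sum1|].
move=> j j' /supp[i wi [ss <-]] /supp[i' wi' [ss' <-]].
have /orP[/asboolP H|/asboolP H] := we i i' wi wi'; apply/orP; [left|right]; apply/asboolP.
  apply/slab_apexP; first exact: relabel_slab.
  by rewrite !relabelE //=; split=> //; case/(slab_apexP _ ss'): H.
apply/slab_apexP; first exact: relabel_slab.
by rewrite !relabelE //=; split=> //; case/(slab_apexP _ ss): H.
Qed.

Lemma bottom_level (w : label -> R) : clique_weights slab_comparable w ->
  slab_part (bary (fun i => p (relabel false i)) w) /\
  F (bary (fun i => p (relabel false i)) w) = a.
Proof.
move=> cw; have cz := bottom_weights cw; rewrite -push_weight_bary; split.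
  by apply/slab_partP/clique_supportP; exists (push_weight (relabel false) w).
have [cz' _] := (slab_weightsP _).1 cz.
rewrite (F_bary cz') push_weight_sum.
have [/clique_weightsP[_ w1 _] ws] := (slab_weightsP _).1 cw.
rewrite -[RHS]mul1r -w1 mulr_suml; apply: eq_bigr => i _.
have [->|/ws ss] := eqVneq (w i) 0; first by rewrite !mul0r.
by rewrite F_apex ?relabelE.
Qed.

Lemma bottom_fiber (w : label -> R) (j : label) : (forall i, w i != 0 -> slab (val i).1) -> slab (val j).1 -> (val j).2 ->
  push_weight (relabel false) w (relabel false j) = w (relabel false j) + w j.
Proof.
move=> ws sj kj.
have ne : relabel false j != j.
  by apply/eqP => E; have := relabelE false sj; rewrite E => Ej; rewrite Ej in kj.
have idem : relabel false (relabel false j) = relabel false j.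
  by apply: val_inj; rewrite !relabelE //; exact: relabel_slab.
rewrite /push_weight (bigD1 j) //= eqxx mulr1 (bigD1 (relabel false j)) //= idem eqxx mulr1.
rewrite big1 ?addr0 1?addrC // => i /andP[ij ibj].
have [->|/ws si] := eqVneq (w i) 0; first by rewrite mul0r.
have [E|] := eqVneq; last by rewrite mulr0.
have := congr1 val E; rewrite !relabelE // => -[st].
case ki: (val i).2.
  by case/eqP: ij; apply: label_ext; rewrite // ki kj.
by case/eqP: ibj; apply: label_ext; rewrite relabelE //= ki.
Qed.

Lemma sum_neg (J : finType) (d : J -> R) i : \sum_j d j = 0 -> d i != 0 -> exists j, d j < 0.
Proof.
move=> s0 di; apply: contrapT => no.
case/eqP: di; apply: (psumr_eq0P (P := xpredT)) => // j _.
by rewrite leNgt; apply/negP => dj; apply: no; exists j.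
Qed.

(* Two weightings of one prism with equal shadow and equal height agree: a
   label carrying more top weight and a label carrying less would each have to
   lie strictly above the other. *)
Lemma prism_inj (w w' : label -> R) : clique_weights slab_comparable w -> clique_weights slab_comparable w' ->
  bary Q w = bary Q w' -> w =1 w'.
Proof.
have ab' := ab; move=> cw cw'; rewrite !bary_prism => /eq_row_mx[E1 /matrixP/(_ 0 0)].
rewrite !mxE => E2.
have Ez : push_weight (relabel false) w =1 push_weight (relabel false) w'.
  apply: (apex_bary_inj sys); rewrite ?push_weight_bary //.
    exact: ((slab_weightsP _).1 (bottom_weights cw)).1.
  exact: ((slab_weightsP _).1 (bottom_weights cw')).1.
have [/clique_weightsP[w0 w1 we] ws] := (slab_weightsP _).1 cw.
have [/clique_weightsP[w0' w1' we'] ws'] := (slab_weightsP _).1 cw'.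
pose d i := if (val i).2 then w i - w' i else 0.
(* The height is [a] plus [b - a] times the mass on upper labels, so equal heights mean equal upper
   mass. *)
have dsum : \sum_i d i = 0.
  have H (v : label -> R) : \sum_i v i = 1 -> (forall i, v i != 0 -> slab (val i).1) ->
      \sum_i v i * F (p i) = a + (b - a) * \sum_i (if (val i).2 then v i else 0).
    move=> v1 vs; have Ea : a = \sum_i v i * a by rewrite -mulr_suml v1 mul1r.
    rewrite [X in _ = X + _]Ea mulr_sumr -big_split.
    apply: eq_bigr => i _ /=; have [->|/vs/F_apex->] := eqVneq (v i) 0.
      by rewrite if_same !mul0r mulr0 addr0.
    by case: (val i).2; rewrite /=; ring.
  rewrite /d (eq_bigr (fun i => (if (val i).2 then w i else 0) - (if (val i).2 then w' i else 0))).
    rewrite sumrB; apply/eqP; rewrite subr_eq0; apply/eqP.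
    move: E2; rewrite (H w) // (H w') // => /addrI/mulfI; apply.
    by rewrite subr_eq0 gt_eqF.
  by move=> i _; case: ifP => _; rewrite ?subrr.
have fib (j : label) : (val j).2 -> slab (val j).1 ->
    w (relabel false j) + w j = w' (relabel false j) + w' j.
  by move=> kj sj; rewrite -!bottom_fiber.
(* Equal shadows force [v], having less upper weight at [j], to have weight on the lower label under
   [j]; its comparability with the upper label [i] gives the inclusion. *)
have cross (v v' : label -> R) (i j : label) : (forall i, 0 <= v i) -> (forall i, 0 <= v' i) ->
    (forall i j, v i != 0 -> v j != 0 -> e i j) ->
    (forall j : label, (val j).2 -> slab (val j).1 -> v (relabel false j) + v j = v' (relabel false j) + v' j) ->
    (val i).2 -> (val j).2 -> slab (val j).1 -> v' i < v i -> v j < v' j ->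
    r (val j).1 `<=` r (val i).1.
  move=> v0 v0' ve vf ki kj sj vi vj.
  have vi0 : v i != 0 by rewrite gt_eqF //; have := v0' i; lra.
  have vj0 : v (relabel false j) != 0.
    by rewrite gt_eqF //; have := vf j kj sj; have := v0' (relabel false j); lra.
  have /orP[/asboolP H|/asboolP H] := ve _ _ vi0 vj0.
    by have [+ _] := label_apex_sub H; rewrite relabelE.
  by have [_] := label_apex_sub H; rewrite relabelE //= ki => /(_ isT).
have dz i : d i = 0.
  apply/eqP; apply: contraT => di.
  have [j dj] := sum_neg dsum di.
  have [k dk] : exists k, 0 < d k.
    have [||k dk] := @sum_neg _ (fun i => - d i) i; rewrite ?sumrN ?dsum ?oppr0 ?oppr_eq0 //.
    by exists k; rewrite -oppr_lt0.
  move: dj dk; rewrite /d; case kj: (val j).2; case kk: (val k).2; rewrite ?ltxx // => dj dk.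
  have sj : slab (val j).1 by apply: ws'; rewrite gt_eqF //; have := w0 j; lra.
  have sk : slab (val k).1 by apply: ws; rewrite gt_eqF //; have := w0' k; lra.
  have jk : r (val j).1 `<=` r (val k).1 by apply: (cross w w') => //; lra.
  have kj' : r (val k).1 `<=` r (val j).1.
    by apply: (cross w' w) => // [l kl sl||]; [rewrite fib|lra|lra].
  have E : j = k.
    apply: label_ext; rewrite ?kj ?kk //; apply: (cell_inj (tc_cplx tc)).
    by apply/seteqP; split.
  by move: dj dk; rewrite E; lra.
move=> i; case ki: (val i).2; first by have := dz i; rewrite /d ki; lra.
have [si|nsi] := pselect (slab (val i).1); last first.
  have z (v : label -> R) : (forall i, v i != 0 -> slab (val i).1) -> v i = 0.
    by move=> vs; apply/eqP; apply: contraT => /vs.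
  by rewrite (z w ws) (z w' ws').
have kt : (val (relabel true i)).2 by rewrite relabelE.
have := fib _ kt (relabel_slab true si).
have -> : relabel false (relabel true i) = i.
  by apply: label_ext; rewrite !relabelE //; exact: relabel_slab.
by have := dz (relabel true i); rewrite /d kt; lra.
Qed.

End SlabProduct.

(** * The vertical flow in the slab *)

Section SlabFlow.
Variables (R : realType) (n : nat) (X : finType) (Lc : X -> seq ('rV[R]_n * R)).
Variables (A : X -> 'rV[R]_n * R) (F : 'rV[R]_n -> R) (a b : R).
Local Notation r s := (hpoly (Lc s)).
Hypothesis (tc : transversal_cells Lc A F a b) (ab : a < b).

Local Notation label := {i : X * bool | label_valid Lc F a i}.
Local Notation p := (apex tc ab).
Local Notation L := (@label_cell R n X Lc A F a).
Local Notation rk := (@label_rank R n X Lc F a).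
Local Notation e := (apex_comparable L p).
Local Notation slab := (slab Lc F a b).
Local Notation se := (slab_comparable tc ab).
Local Notation Q := (prism_vertex tc ab).
Local Notation S := (slab_part tc ab).
Let sys := label_apex_system tc ab.

(** The fraction [lam] of the mass of [y] is lifted from lower to upper labels to reach height [t].
    Lifting by decreasing rank keeps the support a chain: every lifted cell contains every cell not
    fully lifted. *)
Lemma prism_surj y t : S y -> F y = a -> a <= t <= b ->
  exists2 w, clique_weights se w & bary Q w = pt y t.
Proof.
have ab' := ab; move=> /slab_partP/clique_supportP[z cz ->] Fy tab.
have [ez zs] := (slab_weightsP _ _ _).1 cz.
have [z0 z1 ze] := (clique_weightsP _ _).1 ez.
(* A mean equal to [a] leaves no weight for an apex at level [b]. *)
have zk i : z i != 0 -> ~~ (val i).2.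
  move=> zi; apply/negP => ki; have := Fy; rewrite (F_bary ez) => Fa.
  have : - \sum_j z j * F (p j) < - a; last by lra.
  rewrite -sumrN; under eq_bigr do rewrite -mulrN.
  apply: (weighted_le z0 z1 _ zi) => [j /zs sj|]; rewrite ?lerN2 ?ltrN2 (F_apex tc ab) ?ki //; last exact: zs.
  by case: ifP => // _; apply: ltW.
pose lam := (t - a) / (b - a).
have lamE : lam * (b - a) = t - a by rewrite /lam divfK // subr_eq0 gt_eqF.
have lam0 : 0 <= lam by apply: divr_ge0; lra.
have lam1 : lam <= 1 by rewrite ler_pdivrMr ?subr_gt0 //; lra.
clearbody lam.
pose l := sort (fun i j : label => rk j <= rk i)%N [seq i <- enum {: label} | z i != 0].
have ul : uniq l by rewrite sort_uniq filter_uniq // enum_uniq.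
have pl : pairwise (fun i j : label => rk j <= rk i)%N l.
  rewrite -sorted_pairwise; last by move=> i j k h1 h2; apply: leq_trans h2 h1.
  by apply: sort_sorted => i j; apply: leq_total.
have lP i : (i \in l) = (z i != 0) by rewrite mem_sort mem_filter mem_enum andbT.
have suml (f : label -> R) : (forall i, z i = 0 -> f i = 0) -> \sum_(i <- l) f i = \sum_i f i.
  move=> f0; rewrite -big_enum /= (perm_big [seq i <- enum {: label} | z i != 0]); last first.
    by rewrite /l perm_sort.
  rewrite big_filter big_mkcond; apply: eq_bigr => i _.
  by case: eqP => //= /f0.
have [|u [u0 ul0 uc uf]] := @greedy_fill R label rk z l lam ul pl z0.
  by rewrite suml // z1 lam0.
have uz i : z i = 0 -> u i = 0 by move=> zi; apply: ul0; rewrite lP zi eqxx.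
have {}uc : \sum_i u i = lam by rewrite -suml.
pose top := relabel (Lc := Lc) (F := F) (a := a) true.
pose w i := (z i - u i) + push_weight top u i.
have wbary m (q : label -> 'rV[R]_m) : bary q w = bary q (fun i => z i - u i) + bary (fun i => q (top i)) u.
  by rewrite -(push_weight_bary top) /bary -big_split; apply: eq_bigr => i _; rewrite /w scalerDl.
have up i : 0 <= u i by case/andP: (u0 i).
have zu i : 0 <= z i - u i by rewrite subr_ge0; case/andP: (u0 i).
have supp i : w i != 0 -> (z i != 0 /\ u i != z i) \/ exists2 j, z j != 0 & u j != 0 /\ top j = i.
  rewrite /w; have [->|ne] := eqVneq (u i) (z i).
    rewrite subrr add0r => /push_weight_supp[j uj tj]; right; exists j => //.
    by apply: contra_neq uj => /uz.
  move=> wi; have [zi|] := eqVneq (z i) 0; last by left.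
  by case/eqP: ne; rewrite zi uz.
have topE j : z j != 0 -> val (top j) = ((val j).1, true) by move=> /zs sj; apply: (relabelE tc).
have below i j : z i != 0 -> z j != 0 -> (rk j <= rk i)%N -> r (val j).1 `<=` r (val i).1.
  move=> zi zj ji; have /orP[/asboolP H|/asboolP H] := ze i j zi zj.
    exact: (label_apex_sub H).1.
  have [->//|ne] := eqVneq i j.
  by have := apex_rank sys H ne; rewrite ltnNge ji.
have comp i j : z i != 0 -> z j != 0 -> r (val j).1 `<=` r (val i).1 \/ r (val i).1 `<=` r (val j).1.
  move=> zi zj; have [h|h] := leqP (rk j) (rk i); [left; exact: below zi zj h|right].
  exact: below zj zi (ltnW h).
have cw : clique_weights se w.
  apply/slab_weightsP; split; last first.
    by move=> i /supp[[/zs//]|[j zj [_ <-]]]; rewrite topE //; apply: zs.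
  apply/clique_weightsP; split.
  - by move=> i; rewrite /w addr_ge0 // push_weight_ge0.
  - by rewrite /w big_split /= push_weight_sum1 sumrB z1 subrK.
  have mixed i j : z i != 0 -> z j != 0 -> u i != 0 -> u j != z j -> e (top i) j.
    move=> zi zj ui uj; apply/orP; left; apply/asboolP; apply/(slab_apexP _ _ _ (zs _ zj)).
    by rewrite topE //=; split=> //; apply: below => //; apply: uf; rewrite ?lP.
  move=> i j /supp[[zi ui]|[i' zi [ui <-]]] /supp[[zj uj]|[j' zj [uj <-]]].
  - exact: ze.
  - by rewrite /apex_comparable orbC; apply: mixed.
  - exact: mixed.
  - have st k : z k != 0 -> slab (val (top k)).1 by move=> zk'; rewrite topE //; apply: zs.
    have [H|H] := comp i' j' zi zj; apply/orP; [left|right]; apply/asboolP.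
      by apply/(slab_apexP _ _ _ (st _ zj)); rewrite !topE.
    by apply/(slab_apexP _ _ _ (st _ zi)); rewrite !topE.
exists w; first exact: cw.
have botE (i : label) : z i != 0 -> relabel false i = i.
  by move=> zi; have si := zs _ zi; apply: label_ext; rewrite (relabelE tc _ si) // (negbTE (zk i zi)).
have bottopE (j : label) : z j != 0 -> relabel false (top j) = j.
  move=> zj; have sj : slab (val (top j)).1 by rewrite topE //; apply: zs.
  by apply: label_ext; rewrite (relabelE tc _ sj) ?topE // (negbTE (zk j zj)).
have zuz j : z j - u j != 0 -> z j != 0 by apply: contra_neq => zj; rewrite zj uz // subrr.
have uzz j : u j != 0 -> z j != 0 by apply: contra_neq => /uz.
rewrite bary_prism; congr pt.
  rewrite wbary (eq_bary (q' := p)); last by move=> i /zuz/botE->.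
  rewrite [X in _ + X](eq_bary (q' := p)); last by move=> i /uzz/bottopE->.
  by rewrite /bary -big_split; apply: eq_bigr => i _; rewrite /= -scalerDl subrK.
have -> : \sum_i w i * F (p i) = \sum_i (z i - u i) * F (p i) + \sum_i u i * F (p (top i)).
  rewrite -(push_weight_sum top u (fun i => F (p i))) -big_split.
  by apply: eq_bigr => i _; rewrite /w mulrDl.
rewrite (eq_bigr (fun i => (z i - u i) * a)) => [|i _]; last first.
  have [->|/zuz zi] := eqVneq (z i - u i) 0; first by rewrite !mul0r.
  by rewrite (F_apex tc ab (zs _ zi)) (negbTE (zk _ zi)).
rewrite [X in _ + X](eq_bigr (fun i => u i * b)) => [|i _]; last first.
  have [->|/uzz zi] := eqVneq (u i) 0; first by rewrite !mul0r.
  have si : slab (val (top i)).1 by rewrite topE //; apply: zs.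
  by rewrite (F_apex tc ab si) topE.
by rewrite -!mulr_suml sumrB z1 uc; lra.
Qed.

Lemma lsubmx_affine m k (z : 'rV[R]_(m + k)) : lsubmx z = z *m col_mx 1%:M 0 + 0.
Proof. by rewrite -[in RHS](hsubmxK z) mul_row_col mulmx1 mulmx0 !addr0. Qed.

Lemma rsubmx_affine m k (z : 'rV[R]_(m + k)) : rsubmx z = z *m col_mx 0 1%:M + 0.
Proof. by rewrite -[in RHS](hsubmxK z) mul_row_col mulmx1 mulmx0 add0r addr0. Qed.

Lemma pt_lsub (x : 'rV[R]_n) t : lsubmx (pt x t) = x.
Proof. by rewrite /pt row_mxKl. Qed.

Lemma pt_rsub (x : 'rV[R]_n) t : rsubmx (pt x t) = const_mx t.
Proof. by rewrite /pt row_mxKr. Qed.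

Definition in_prism (z : 'rV[R]_(n + 1)) := S (lsubmx z) /\ a <= rsubmx z 0 0 <= b.

(** The simplicial map [G] straightens the slab part to a prism in which [F] is the height, and [K]
    inverts it. Thus [theta y t] moves [y] vertically to height [t], from any starting level, so one
    flow serves every [c]. *)
Lemma slab_flow : exists theta : 'rV[R]_n -> R -> 'rV[R]_n,
  [/\ PL_map S (fun y => const_mx (F y) : 'rV[R]_1),
      PL_map in_prism (fun z => theta (lsubmx z) (rsubmx z 0 0)),
      forall y t, S y -> a <= t <= b -> S (theta y t) /\ F (theta y t) = t,
      forall y t t', S y -> a <= t <= b -> theta (theta y t) t' = theta y t' &
      forall y, S y -> theta y (F y) = y].
Proof.
have SE : S = cplx_support (clique_cells se p) by apply/seteqP; split=> y /slab_partP.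
have [G [PLG GE]] := simplicial_map (e := se) (q := p)
  (fun w w' cw cw' => apex_bary_inj sys ((slab_weightsP _ _ _).1 cw).1 ((slab_weightsP _ _ _).1 cw').1) Q.
have [K [PLK KE]] := simplicial_map (e := se) (q := Q) (@prism_inj _ _ _ _ _ _ _ _ tc ab) p.
rewrite -SE in PLG.
have SP y : S y -> exists2 w, clique_weights se w & y = bary p w.
  by rewrite SE => /clique_supportP.
have GF y : S y -> rsubmx (G y) = const_mx (F y).
  move=> /SP[w cw ->]; rewrite GE // bary_prism pt_rsub (F_bary (w := w)) //.
  exact: ((slab_weightsP _ _ _).1 cw).1.
have GS y : S y -> S (lsubmx (G y)) /\ F (lsubmx (G y)) = a.
  by move=> /SP[w cw ->]; rewrite GE // bary_prism pt_lsub; apply: bottom_level.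
have lift y t : S y -> a <= t <= b ->
    exists2 w, clique_weights se w & bary Q w = pt (lsubmx (G y)) t.
  by move=> /GS[Sy Fy] tab; apply: prism_surj.
have KG y t : S y -> a <= t <= b ->
    S (K (pt (lsubmx (G y)) t)) /\ G (K (pt (lsubmx (G y)) t)) = pt (lsubmx (G y)) t.
  move=> Sy tab; have [w cw <-] := lift y t Sy tab; rewrite KE // GE //; split=> //.
  by apply/slab_partP/clique_supportP; exists w.
exists (fun y t => K (pt (lsubmx (G y)) t)); split.
- have GF' y : S y -> G y *m col_mx 0 1%:M + 0 = const_mx (F y) by move=> Sy; rewrite -rsubmx_affine GF.
  apply: (PL_ext GF').
  exact: (PL_comp PLG (PL_affine (col_mx 0 1%:M : 'M[R]_(n + 1, 1)) 0 (PL_id R _)) (fun y Sy => I)).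
- pose col1 : 'M[R]_(n + 1, n) := col_mx 1%:M 0.
  have PLl : PL_map in_prism (fun z => lsubmx z).
    have := PL_preim (col1 : 'M[R]_(n + 1, n)) 0 col1 0 PLG.
    have := PL_preim (col1 : 'M[R]_(n + 1, n)) 0 (col_mx 0 1%:M : 'M[R]_(n + 1, 1)) 0 PLG.
    move=> P1 P2; have := PL_restrict P2 P1 (polyhedral_setI (polyhedral_coordge 0 a) (polyhedral_coord (0 : 'I_1) b)).
    have -> : [set z | S (z *m col1 + 0)] `&` [set x |
       ([set x0 : 'rV[R]_1 | a <= x0 0 0] `&` [set x0 : 'rV[R]_1 | x0 0 0 <= b])
         (x *m col_mx 0 1%:M + 0)] = in_prism.
      apply/seteqP; split=> z; rewrite /in_prism /= -lsubmx_affine -rsubmx_affine.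
        by move=> [Sz [h1 h2]]; split=> //; apply/andP.
      by move=> [Sz /andP[h1 h2]].
    by apply: PL_ext => z _; rewrite -lsubmx_affine.
  have PLr : PL_map in_prism (fun z => rsubmx z).
    by apply: PL_ext (PL_affine (col_mx 0 1%:M) 0 PLl) => z _; rewrite -rsubmx_affine.
  have PLGl := PL_comp PLl PLG (fun z zS => zS.1).
  have PLGll : PL_map in_prism (fun z => lsubmx (G (lsubmx z))).
    apply: PL_ext (PL_comp PLGl (PL_affine col1 0 (PL_id R _)) (fun y Sy => I)) => z _.
    by rewrite -lsubmx_affine.
  apply: PL_ext (PL_comp (PL_pair PLGll PLr) PLK _) => [z _|z [Sz tab]].
    congr K; rewrite /pt; congr row_mx.
    by apply/rowP => i; rewrite (ord1 i) [RHS]mxE.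
  have [w cw E] := lift _ _ Sz tab; apply/clique_supportP; exists w => //; rewrite E /pt.
  by congr row_mx; apply/rowP => i; rewrite (ord1 i) [RHS]mxE.
- move=> y t Sy tab; have [Sk Gk] := KG y t Sy tab; split=> //.
  by have /rowP/(_ 0) := GF _ Sk; rewrite Gk pt_rsub !mxE.
- by move=> y t t' Sy tab; have [_ ->] := KG y t Sy tab; rewrite pt_lsub.
- move=> y Sy; have -> : pt (lsubmx (G y)) (F y) = G y by rewrite /pt -GF // hsubmxK.
  by have [w cw ->] := SP y Sy; rewrite GE // KE.
Qed.

End SlabFlow.

(** * From the flow to the product structure *)

Section ProductFromFlow.
Variables (R : realType) (n : nat) (S : set 'rV[R]_n) (F : 'rV[R]_n -> R) (a b : R).
Variable theta : 'rV[R]_n -> R -> 'rV[R]_n.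
Let prism := [set z : 'rV[R]_(n + 1) | S (lsubmx z) /\ a <= rsubmx z 0 0 <= b].
Hypothesis PLF : PL_map S (fun y => const_mx (F y) : 'rV[R]_1).
Hypothesis PLT : PL_map prism (fun z => theta (lsubmx z) (rsubmx z 0 0)).
Hypothesis thetaS : forall y t, S y -> a <= t <= b -> S (theta y t) /\ F (theta y t) = t.
Hypothesis thetaD : forall y t t', S y -> a <= t <= b -> theta (theta y t) t' = theta y t'.
Hypothesis theta_id : forall y, S y -> theta y (F y) = y.

Let rsub_pt (x : 'rV[R]_n) t : rsubmx (pt x t) 0 0 = t.
Proof. by rewrite pt_rsub mxE. Qed.

Lemma PL_flow_at c : a <= c <= b -> PL_map S (fun y => theta y c).
Proof.
move=> cab.
have PLp : PL_map S (fun y => y *m row_mx 1%:M 0 + pt 0 c) by apply: PL_affine PLF.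
have ptE y : y *m row_mx 1%:M 0 + pt 0 c = pt y c.
  by rewrite /pt mul_mx_row mulmx1 mulmx0 add_row_mx addr0 add0r.
apply: PL_ext (PL_comp PLp PLT _) => y Sy; rewrite ptE ?pt_lsub ?rsub_pt //.
by rewrite /prism /= pt_lsub rsub_pt.
Qed.

Lemma PL_level_restrict k (f : 'rV[R]_n -> 'rV[R]_k) (J : set R) :
  polyhedral_set [set v : 'rV[R]_1 | J (v 0 0)] -> PL_map S f ->
  PL_map [set y | S y /\ J (F y)] f.
Proof.
move=> polyJ PLf; have := PL_restrict PLf PLF polyJ.
rewrite (_ : S `&` _ = [set y | S y /\ J (F y)]) //.
by apply/seteqP; split=> y [Sy /=]; rewrite mxE.
Qed.

Let poly1_point (c : R) : polyhedral_set [set v : 'rV[R]_1 | v 0 0 = c].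
Proof.
have := polyhedral_point (const_mx c : 'rV[R]_1); congr polyhedral_set.
apply/seteqP; split=> v /= => [->|vc]; first by rewrite mxE.
by apply/rowP => i; rewrite (ord1 i) mxE.
Qed.

(** The inverse flows back to level [c] and records the height. The end [d] is separate from [b]
    because the flow lives over the widened interval. *)
Lemma flow_product d c : a <= c <= d -> d <= b ->
  exists phi : 'rV[R]_(n + 1) -> 'rV[R]_n,
    PL_homeo [set z | exists x t, z = pt x t /\ S x /\ F x = c /\ a <= t <= d]
             [set y | S y /\ a <= F y <= d] phi /\
    (forall t, a <= t <= d ->
      PL_homeo [set x | S x /\ F x = c] [set y | S y /\ F y = t] (fun x => phi (pt x t))).
Proof.
move=> cad db; pose Theta (z : 'rV[R]_(n + 1)) := theta (lsubmx z) (rsubmx z 0 0).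
have cab : a <= c <= b by lra.
have tab t : a <= t <= d -> a <= t <= b by lra.
exists Theta; split.
  apply: (@PL_homeoI _ _ _ _ _ _ (fun y => pt (theta y c) (F y))).
  - have PLl : PL_map prism (fun z => lsubmx z).
      by apply: PL_ext (PL_affine (col_mx 1%:M 0) 0 PLT) => z _; rewrite -lsubmx_affine.
    have PLFl := PL_comp PLl PLF (fun z zS => zS.1).
    have P1 := PL_restrict PLT PLFl (poly1_point c).
    have P2 := PL_restrict P1 (PL_affine (col_mx 0 1%:M : 'M[R]_(n + 1, 1)) 0 P1) (polyhedral_coord 0 d).
    rewrite (_ : [set z | _] = prism `&` [set z | (const_mx (F (lsubmx z)) : 'rV[R]_1) 0 0 = c]
      `&` [set z : 'rV[R]_(n + 1) | (z *m (col_mx 0 1%:M : 'M[R]_(n + 1, 1)) + 0) 0 0 <= d]) //.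
    apply/seteqP; split=> z /=; rewrite -rsubmx_affine mxE.
      by move=> [x [t [-> [Sx [Fx td]]]]]; rewrite /prism /= pt_lsub rsub_pt; split; [split=> //; split=> //; lra|lra].
    move=> [[[Sz zab] Fz] zd]; exists (lsubmx z), (rsubmx z 0 0); split.
      rewrite /pt -[LHS]hsubmxK; congr row_mx.
      by apply/rowP => i; rewrite (ord1 i) [RHS]mxE.
    by split=> //; split=> //; lra.
  - have polyJ : polyhedral_set [set v : 'rV[R]_1 | [set s | a <= s <= d] (v 0 0)].
      rewrite (_ : [set v | _] = [set v : 'rV[R]_1 | a <= v 0 0] `&` [set v : 'rV[R]_1 | v 0 0 <= d]).
        exact: polyhedral_setI (polyhedral_coordge _ _) (polyhedral_coord _ _).
      by apply/seteqP; split=> v /= => [/andP[]|[h1 h2]] //; apply/andP.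
    exact: (PL_level_restrict polyJ (PL_pair (PL_flow_at cab) PLF)).
  - move=> z [x [t [-> [Sx [Fx td]]]]]; rewrite /Theta pt_lsub rsub_pt /=.
    by have [St ->] := thetaS Sx (tab t td).
  - move=> y [Sy Fy]; have [Sc Fc] := thetaS Sy cab.
    by exists (theta y c), (F y).
  - move=> z [x [t [-> [Sx [Fx td]]]]]; rewrite /Theta pt_lsub rsub_pt.
    have [St ->] := thetaS Sx (tab t td).
    by rewrite thetaD ?tab // -Fx theta_id.
  - move=> y [Sy Fy]; rewrite /Theta pt_lsub rsub_pt thetaD //.
    exact: theta_id.
move=> t td; have ttab := tab t td.
have TE x : Theta (pt x t) = theta x t by rewrite /Theta pt_lsub rsub_pt.
apply: (@PL_homeoI _ _ _ _ _ _ (fun y => theta y c)).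
- apply: (@PL_level_restrict _ _ [set s | s = c]); first exact: poly1_point.
  by apply: PL_ext (PL_flow_at ttab) => x _; rewrite TE.
- apply: (@PL_level_restrict _ _ [set s | s = t]); first exact: poly1_point.
  exact: PL_flow_at.
- by move=> x [Sx _]; rewrite TE; apply: thetaS.
- by move=> y [Sy _]; apply: thetaS.
- by move=> x [Sx Fx]; rewrite TE thetaD // -Fx theta_id.
- by move=> y [Sy Fy]; rewrite TE thetaD // -Fy theta_id.
Qed.

End ProductFromFlow.

(** * Indexing the cells and widening the interval *)

Section FiniteComplex.
Variables (R : realType) (n : nat).

(** The empty cell is discarded, as it has no point to serve as apex. *)
Lemma complex_cells (C : set (set 'rV[R]_n)) : polyhedral_complex C ->
  exists (X : finType) (Lc : X -> seq ('rV[R]_n * R)),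
    [/\ cell_complex Lc, forall s, C (hpoly (Lc s)) &
        forall x, cplx_support C x <-> exists s, hpoly (Lc s) x].
Proof.
move=> [finC [polyC [faceC meetC]]].
have fin : finite_set (C `&` [set P | P !=set0]) by apply: sub_finite_set finC => P [].
have /finite_seqP[fs fsE] := fin.
have fsP (P : set 'rV[R]_n) : (P \in fs) <-> C P /\ P !=set0.
  have E : [set` fs] P <-> (C `&` [set P | P !=set0]) P by rewrite fsE.
  exact: E.
have rep (s : seq_sub fs) : exists l, val s = hpoly l.
  by have [CP _] := (fsP _).1 (valP s); apply: polyC CP.
have [Lc LcE] := choice rep.
exists (seq_sub fs), Lc; split.
- split.
  + by move=> s t E; apply: val_inj; rewrite !LcE.
  + by move=> s; rewrite -LcE; case: ((fsP _).1 (valP s)).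
  + move=> s G G0 fG; have CG : C G.
      by apply: faceC fG; rewrite -LcE; case: ((fsP _).1 (valP s)).
    have Gfs : G \in fs by apply/fsP.
    by exists (SeqSub Gfs); rewrite -LcE.
  + move=> s t; have := meetC (val s) (val t); rewrite !LcE => H.
    by apply: (H _ _).1; rewrite -LcE; [case: ((fsP _).1 (valP s))|case: ((fsP _).1 (valP t))].
- by move=> s; rewrite -LcE; case: ((fsP _).1 (valP s)).
- move=> x; split=> [[P CP Px]|[s sx]].
    have Pfs : P \in fs by apply/fsP; split=> //; exists x.
    by exists (SeqSub Pfs); rewrite -LcE.
  by exists (val s); rewrite ?LcE // -LcE; case: ((fsP _).1 (valP s)).
Qed.

(** Only finitely many cells are flat, so their values above [b] stay away from [b]. *)
Lemma widen_thresholds (X : finType) (r : X -> set 'rV[R]_n) (F : 'rV[R]_n -> R) (b : R) :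
  (forall s, r s !=set0) ->
  exists2 b', b < b' & forall s v, (forall x, r s x -> F x = v) -> b < v -> b' < v.
Proof.
move=> r0.
suff H (l : seq X) : exists2 b', b < b' & forall s v, s \in l ->
    (forall x, r s x -> F x = v) -> b < v -> b' < v.
  by have [b' bb' H'] := H (enum X); exists b' => // s v; apply: H'; rewrite mem_enum.
elim: l => [|s l [b' bb' IH]]; first by exists (b + 1) => //; lra.
have [[v [Fv bv]]|no] := pselect (exists v, (forall x, r s x -> F x = v) /\ b < v); last first.
  exists b' => // t v; rewrite inE => /orP[/eqP-> Fv bv|]; last exact: IH.
  by case: no; exists v.
exists (Num.min b' ((b + v) / 2)); first by rewrite lt_min bb' /=; lra.
move=> t v'; rewrite inE gt_min => /orP[/eqP-> Fv' _|tl Fv' bv']; last by rewrite (IH t v').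
have [x sx] := r0 s; have E : v' = v by rewrite -(Fv x sx) -(Fv' x sx).
by rewrite E; apply/orP; right; lra.
Qed.

End FiniteComplex.

Theorem theorem1p3 (R : realType) (n : nat) (C : set (set 'rV[R]_n))
    (F : 'rV[R]_n -> R) (a b : R) :
  polyhedral_complex C ->
  affine_on_cells C F ->
  a <= b ->
  transversal_thresholds C F a b ->
  exists (D : set (set 'rV[R]_n)) (H : 'rV[R]_n -> R -> 'rV[R]_n),
    polytopal_complex D /\
    cplx_support D `<=` cplx_support C /\
    strong_deformation_retraction (cplx_support C) (cplx_support D) H /\
    (forall x, cplx_support C x -> a <= F x <= b -> F (H x 1) = F x) /\
    (forall c, a <= c <= b ->
       (fun x => H x 1) @` [set x | cplx_support C x /\ F x <= c]
         = [set y | cplx_support D y /\ F y <= c] /\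
       (fun x => H x 1) @` [set x | cplx_support C x /\ c <= F x]
         = [set y | cplx_support D y /\ c <= F y]) /\
    (forall c, a <= c <= b ->
       exists phi : 'rV[R]_(n + 1) -> 'rV[R]_n,
         PL_homeo
           [set z | exists x t, z = pt x t /\ cplx_support D x /\ F x = c /\ a <= t <= b]
           [set y | cplx_support D y /\ a <= F y <= b]
           phi /\
         (forall t, a <= t <= b ->
            PL_homeo [set x | cplx_support D x /\ F x = c]
                     [set y | cplx_support D y /\ F y = t]
                     (fun x => phi (pt x t)))).
Proof.
move=> cplxC affC ab transC.
have [X [Lc [cplx LcC suppC]]] := complex_cells cplxC.
have Aex s : exists u : 'rV[R]_n * R, forall x, hpoly (Lc s) x -> F x = dotv u.1 x + u.2.
  by have [u [v uv]] := affC _ (LcC s); exists (u, v).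
have [A AE] := choice Aex.
have [b' bb' wide] := @widen_thresholds R n X (fun s => hpoly (Lc s)) F b (fun s => @cell_nonempty _ _ _ _ cplx s).
have tc : transversal_cells Lc A F a b'.
  split=> // s v vab Fv; have [x0 sx0] := @cell_nonempty _ _ _ _ cplx s.
  have [vb|bv] := leP v b; last by have := wide s v Fv bv; lra.
  apply: (transC _ (LcC s)); first by split; [exists x0|exists v].
  by move=> _ [x sx <-] /=; rewrite (Fv x sx); lra.
have ab' : a < b' by lra.
have sys := label_apex_system tc ab'.
have suppE : cplx_support C = apex_support (@label_cell R n X Lc A F a).
  apply/seteqP; split=> x.
    by move=> /suppC sx; apply/(apex_supportP tc).
  by move=> /(apex_supportP tc) sx; apply/suppC.
pose ret := apex_retract (@label_cell R n X Lc A F a) (apex tc ab') (@label_rank R n X Lc F a).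
pose D := clique_cells (apex_comparable (@label_cell R n X Lc A F a) (apex tc ab')) (apex tc ab').
exists D, (apex_homotopy (@label_cell R n X Lc A F a) (apex tc ab') (@label_rank R n X Lc F a)).
have DC y : cplx_support D y -> cplx_support C y by rewrite suppE; apply: (apex_cells_sub sys).
have retD x : cplx_support C x -> cplx_support D (ret x).
  by rewrite suppE; apply: (apex_retract_cells sys).
have H1 x : apex_homotopy (@label_cell R n X Lc A F a) (apex tc ab') (@label_rank R n X Lc F a) x 1 = ret x.
  by rewrite /apex_homotopy scale1r addrC subrK.
have lev x : cplx_support C x ->
    (a <= F x <= b' -> F (ret x) = F x) /\ (b' <= F x -> b' <= F (ret x)).
  by rewrite suppE; apply: retract_level.
have low x : cplx_support C x -> F x <= a -> F (ret x) <= a.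
  by rewrite suppE => Cx; apply: (retract_side tc ab' (k := false) Cx).
split; first by apply: clique_cells_polytopal; apply: (apex_bary_inj sys).
split; first exact: DC.
split; first by rewrite suppE; apply: apex_deformation sys.
split; first by move=> x Cx Fx; rewrite H1; apply: (lev x Cx).1; lra.
split.
  move=> c cab; split; apply/seteqP; split=> y.
  - move=> [x [Cx Fx] <-]; rewrite H1; split; first exact: retD.
    (* Levels below [a] may change but stay at most [a], hence at most [c]. *)
    have [xa|xa] := leP (F x) a; first by have := low x Cx xa; lra.
    by rewrite (lev x Cx).1 //; lra.
  (* The retraction fixes [D], so [y] is its own preimage. *)
  - move=> [Dy Fy]; exists y; first by split=> //; apply: DC.
    by rewrite H1; apply: (apex_retract_id sys).
  - move=> [x [Cx Fx] <-]; rewrite H1; split; first exact: retD.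
    have [xb|xb] := leP (F x) b'; first by rewrite (lev x Cx).1 //; lra.
    by have := (lev x Cx).2 (ltW xb); lra.
  - move=> [Dy Fy]; exists y; first by split=> //; apply: DC.
    by rewrite H1; apply: (apex_retract_id sys).
move=> c cab; have [theta [PLF PLT tS tD tid]] := slab_flow tc ab'.
have [phi [phi1 phi2]] := flow_product PLF PLT tS tD tid cab (ltW bb').
exists phi; split.
  move: phi1; congr PL_homeo; apply/seteqP; split.
  - by move=> z [x [t [-> [[Dx _] [Fx tb]]]]]; exists x, t.
  - move=> z [x [t [-> [Dx [Fx tb]]]]]; exists x, t; split=> //; split=> //.
    by split=> //; rewrite Fx; lra.
  - by move=> y [[Dy _] Fy].
  - by move=> y [Dy Fy]; split=> //; split=> //; lra.
move=> t tb; move: (phi2 t tb); congr PL_homeo; apply/seteqP; split.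
- by move=> x [[Dx _] Fx].
- by move=> x [Dx Fx]; split=> //; split=> //; rewrite Fx; lra.
- by move=> x [[Dx _] Fx].
- by move=> x [Dx Fx]; split=> //; split=> //; rewrite Fx; lra.
Qed.
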